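(* For any mixed braid $\alpha\in B_{\mathrm{aff},n}$ with $n$ strands, $$\Delta^{G(e,1)}(\widehat\alpha)=(-1)^{n-1}q^{-\frac{n-wr(\widehat\alpha)-1}{2}}\,\frac{1-q}{1-q^n}\sum_{\substack{0\le a\le n-1\\ 1\le p\le e}}(-1)^a\,C(e,p)\Bigg(\prod_{\substack{1\le l\le e\\ l\ne p}}\frac1{u_p-u_l}\Bigg)\chi_{\boldsymbol\lambda_p^{(a)}}(\pi_n(\alpha)),$$ where $$C(e,p)=\prod_{i=1}^{e-1}\Big(u_p^{e-i-1}\sum_{j=1}^{i}(-1)^{i-j}y_j\sigma_{i-j}\Big)+(-1)^{e-1}\prod_{\substack{1\le l\le e\\ l\ne p}}u_l,$$ $\sigma_d$ is the $d$-th elementary symmetric polynomial in $u_1,\dots,u_e$ ($\sigma_0=1$), and $\chi_{\boldsymbol\lambda_p^{(a)}}$ is the irreducible character of the Ariki-Koike algebra $H_{e,n}$ attached to the $e$-tuple of Young diagrams $\boldsymbol\lambda_p^{(a)}=(\emptyset,\dots,\emptyset,\lambda^{(a)},\emptyset,\dots,\emptyset)$ with the hook $\lambda^{(a)}=(a+1,1,\dots,1)$ of size $n$ in position $p$.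
   Context: $e,n$ are positive integers and $\Bbbk=\mathbb{Q}(q,u_1,\dots,u_e)$ with $q,u_1,\dots,u_e$ indeterminates. Affine braid group: $B_{\mathrm{aff},n}$ is the group with generators $t_0,t_1,\dots,t_{n-1}$ and relations $t_0t_1t_0t_1=t_1t_0t_1t_0$, $t_it_j=t_jt_i$ ($|i-j|\ge2$), $t_it_{i+1}t_i=t_{i+1}t_it_{i+1}$ ($1\le i\le n-2$). It is identified with the group of equivalence classes of mixed braids with $n$ strands (braids in the complement of a fixed vertical cylinder, $t_0$ being the first strand looping around the cylinder and $t_1,\dots,t_{n-1}$ the usual crossings). The closure $\widehat\alpha$ of a mixed braid $\alpha$ is a mixed link, i.e. a link in the solid torus. Ariki-Koike algebra: $H_{e,n}$ is the associative $\Bbbk$-algebra with generators $T_0,\dots,T_{n-1}$ and relations $(T_0-u_1)\cdots(T_0-u_e)=0$, $(T_i-q)(T_i+1)=0$ ($1\le i\le n-1$), $T_0T_1T_0T_1=T_1T_0T_1T_0$, $T_iT_j=T_jT_i$ ($|i-j|\ge2$), $T_iT_{i+1}T_i=T_{i+1}T_iT_{i+1}$ ($1\le i\le n-2$). One has $H_{e,1}\subset H_{e,2}\subset\cdots$; put $H_e=\bigcup_n H_{e,n}$ and $L_i=T_i\cdots T_1T_0T_1^{-1}\cdots T_i^{-1}$. Let $\pi_n:B_{\mathrm{aff},n}\to H_{e,n}^{\times}$ be the group homomorphism $t_i\mapsto T_i$ ($0\le i\le n-1$). Markov trace: for parameters $z,y_1,\dots,y_{e-1}$, the Markov trace $\tau$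 is the linear map on $H_e$ (existing and unique by a result of Lambropoulou) such that $\tau(1)=1$; $\tau(hh')=\tau(h'h)$ ($h,h'\in H_{e,n}$); $\tau(hT_i)=z\tau(h)$ ($h\in H_{e,n}$, $1\le i\le n$); $\tau(hL_i^{j})=y_j\tau(h)$ ($h\in H_{e,n}$, $0\le i\le n-1$, $1\le j\le e-1$). Invariants: introduce the variable $t=\frac{1-q+z}{qz}$, i.e. $z=-\frac{1-q}{1-tq}$. The HOMFLYPT polynomial of type $G(e,1)$ of $\widehat\alpha$, for $\alpha\in B_{\mathrm{aff},n}$, is $$X_{\widehat\alpha}(q,t)=\Big[-\frac{1-tq}{t^{1/2}(1-q)}\Big]^{n-1}(t^{1/2})^{wr(\widehat\alpha)}\,\tau(\pi_n(\alpha)),$$ where $wr(\widehat\alpha)$ is the writhe number of the mixed link $\widehat\alpha$. It can be evaluated at $t=q^{-1}$, and the Alexander polynomial of type $G(e,1)$ is $\Delta^{G(e,1)}(\widehat\alpha)=X_{\widehat\alpha}(q,q^{-1})$. Characters: $\chi_{\boldsymbol\lambda_p^{(a)}}$ is the character of the following $H_{e,n}$-module (Ariki-Koike). It has a $\Bbbk$-basis $\{\mathbf t\}$ indexed by the standard tableaux $\mathbf T$ of shape $\lambda^{(a)}$ (fillings by $1,\dots,n$ increasing along rows and columns). $T_0\mathbf t=u_p\mathbf t$. For $1\le i\le n-1$: $T_i\mathbf t=q\mathbf t$ if $i,i+1$ are adjacent in the same row; $T_i\mathbf t=-\mathbf t$ if they are adjacent in the same column; otherwise, with $\mathbf T'$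 obtained from $\mathbf T$ by exchanging $i$ and $i+1$ and $k=c(i)-c(i+1)$ (where $c(i)$ is the content, column number minus row number, of the box containing $i$ in $\mathbf T$), $T_i\mathbf t=\frac{1}{1-q^k}\big((q-1)\mathbf t+q(1-q^{k-1})\mathbf t'\big)$.
   Formalization: In C(e,p) the product over i=1..e-1 is replaced by a sum, and the power of q is q^{(n-wr-1)/2} instead of q^{-(n-wr-1)/2}; the printed formula is false. The trace rules for T_i and L_i^j are taken for h in H_{e,i}, as needed for τ to exist. *)

(* Defs.v *)
From HB Require Import structures.
From mathcomp Require Import all_boot all_order all_algebra generic_quotient.
From mathcomp Require Import perm boolp.
From mathcomp Require Import mpoly.

Set Implicit Arguments.
Unset Strict Implicit.
Unset Printing Implicit Defensive.

Import GRing.Theory.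
Local Open Scope ring_scope.
Local Open Scope quotient_scope.

(* Algebras and groups given by generators and relations are quotients of term
   algebras by the least congruence containing the axioms of the structure and
   the defining relations. *)

Section AlgebraTerms.
Variables (k : nzRingType) (I : Type).

Inductive aterm :=
| AVar of I
| AConst of k
| AAdd of aterm & aterm
| AMul of aterm & aterm.

HB.instance Definition _ := gen_eqMixin aterm.
HB.instance Definition _ := gen_choiceMixin aterm.

Inductive acong (R : aterm -> aterm -> Prop) : aterm -> aterm -> Prop :=
| acong_rel x y : R x y -> acong R x y
| acong_refl x : acong R x x
| acong_sym x y : acong R x y -> acong R y x
| acong_trans y x z : acong R x y -> acong R y z -> acong R x z
| acong_add x x' y y' :
    acong R x x' -> acong R y y' -> acong R (AAdd x y) (AAdd x' y')
| acong_mul x x' y y' :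
    acong R x x' -> acong R y y' -> acong R (AMul x y) (AMul x' y')
| acong_addA x y z : acong R (AAdd x (AAdd y z)) (AAdd (AAdd x y) z)
| acong_addC x y : acong R (AAdd x y) (AAdd y x)
| acong_add0 x : acong R (AAdd (AConst 0) x) x
| acong_addN x : acong R (AAdd (AMul (AConst (-1)) x) x) (AConst 0)
| acong_mulA x y z : acong R (AMul x (AMul y z)) (AMul (AMul x y) z)
| acong_mul1 x : acong R (AMul (AConst 1) x) x
| acong_mulDl x y z :
    acong R (AMul (AAdd x y) z) (AAdd (AMul x z) (AMul y z))
| acong_mulDr x y z :
    acong R (AMul x (AAdd y z)) (AAdd (AMul x y) (AMul x z))
| acong_constD a b : acong R (AConst (a + b)) (AAdd (AConst a) (AConst b))
| acong_constM a b : acong R (AConst (a * b)) (AMul (AConst a) (AConst b))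
| acong_constC a x : acong R (AMul (AConst a) x) (AMul x (AConst a)).

Definition acongb R x y : bool := `[< acong R x y >].

Lemma acongb_refl R : reflexive (acongb R).
Proof. by move=> x; apply/asboolP/acong_refl. Qed.

Lemma acongb_sym R : ssrbool.symmetric (acongb R).
Proof.
by move=> x y; apply/idP/idP => /asboolP h; apply/asboolP; apply: acong_sym.
Qed.

Lemma acongb_trans R : transitive (acongb R).
Proof.
by move=> y x z /asboolP h /asboolP h'; apply/asboolP; apply: acong_trans h'.
Qed.

Definition acong_equiv R : equiv_rel aterm :=
  EquivRel (acongb R) (@acongb_refl R) (@acongb_sym R) (@acongb_trans R).

End AlgebraTerms.

Arguments AConst {k I}.

Fixpoint aeval (k : nzRingType) (I : Type) (B : algType k) (f : I -> B)
    (x : aterm k I) : B :=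
  match x with
  | AVar i => f i
  | AConst c => c%:A
  | AAdd x y => aeval f x + aeval f y
  | AMul x y => aeval f x * aeval f y
  end.

Lemma aeval_sound (k : comNzRingType) (I : Type) (B : algType k) (f : I -> B)
    (R : aterm k I -> aterm k I -> Prop) :
    (forall x y, R x y -> aeval f x = aeval f y) ->
  forall x y, acong R x y -> aeval f x = aeval f y.
Proof.
move=> Rf x y; elim=> //= {x y}.
- by move=> y x z _ -> _ ->.
- by move=> x x' y y' _ -> _ ->.
- by move=> x x' y y' _ -> _ ->.
- by move=> x y z; rewrite addrA.
- by move=> x y; rewrite addrC.
- by move=> x; rewrite scale0r add0r.
- by move=> x; rewrite scaleN1r mulN1r addNr scale0r.
- by move=> x y z; rewrite mulrA.
- by move=> x; rewrite scale1r mul1r.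
- by move=> x y z; rewrite mulrDl.
- by move=> x y z; rewrite mulrDr.
- by move=> a b; rewrite scalerDl.
- by move=> a b; rewrite mulr_algl scalerA.
- by move=> a x; rewrite mulr_algl mulr_algr.
Qed.

Section ArikiKoike.
Variables (k : fieldType) (e : nat) (q : k) (u : 'I_e -> k) (n : nat).

Local Notation term := (aterm k 'I_n).
Local Notation V i := (AVar k (i : 'I_n)).
Local Notation "x ** y" := (AMul x y) (at level 40, left associativity).

(* The guard 0 < e keeps the algebra nonzero for every e, as the ring
   structures of the library require; it is vacuous for e positive. *)
Inductive ak_rel : term -> term -> Prop :=
| AK_cyclotomic (i : 'I_n) : i = 0%N :> nat -> (0 < e)%N ->
    ak_rel (\big[@AMul k 'I_n/AConst 1]_(p < e) AAdd (V i) (AConst (- u p)))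
           (AConst 0)
| AK_quadratic (i : 'I_n) : (0 < i)%N ->
    ak_rel (AAdd (V i) (AConst (- q)) ** AAdd (V i) (AConst 1)) (AConst 0)
| AK_braid4 (i j : 'I_n) : i = 0%N :> nat -> j = 1%N :> nat ->
    ak_rel (V i ** V j ** V i ** V j) (V j ** V i ** V j ** V i)
| AK_comm (i j : 'I_n) : (i.+1 < j)%N -> ak_rel (V i ** V j) (V j ** V i)
| AK_braid3 (i j : 'I_n) : (0 < i)%N -> j = i.+1 :> nat ->
    ak_rel (V i ** V j ** V i) (V j ** V i ** V j).

Definition akAlg := {eq_quot acong_equiv ak_rel}.

HB.instance Definition _ := Choice.on akAlg.
HB.instance Definition _ := EqQuotient.on akAlg.

Local Notation pi x := (\pi_akAlg x).

Lemma ak_piP (x y : term) : pi x = pi y <-> acong ak_rel x y.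
Proof.
split=> [/eqP|h]; first by rewrite piE => /asboolP.
by apply/eqP; rewrite piE; apply/asboolP.
Qed.

Lemma ak_reprP (x : term) : acong ak_rel (repr (pi x)) x.
Proof. by apply/ak_piP; rewrite reprK. Qed.

Lemma ak_ind (P : akAlg -> Prop) : (forall x, P (pi x)) -> forall x, P x.
Proof. by move=> h x; rewrite -[x]reprK. Qed.

Definition ak_add (x y : akAlg) : akAlg := pi (AAdd (repr x) (repr y)).
Definition ak_mul (x y : akAlg) : akAlg := pi (repr x ** repr y).
Definition ak_const (c : k) : akAlg := pi (AConst c).

Lemma ak_addE x y : ak_add (pi x) (pi y) = pi (AAdd x y).
Proof. by apply/ak_piP; apply: acong_add; apply: ak_reprP. Qed.

Lemma ak_mulE x y : ak_mul (pi x) (pi y) = pi (x ** y).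
Proof. by apply/ak_piP; apply: acong_mul; apply: ak_reprP. Qed.

Let akE := (ak_addE, ak_mulE).

Fact ak_addA : associative ak_add.
Proof.
elim/ak_ind=> x; elim/ak_ind=> y; elim/ak_ind=> z; rewrite !akE.
exact/ak_piP/acong_addA.
Qed.

Fact ak_addC : commutative ak_add.
Proof.
by elim/ak_ind=> x; elim/ak_ind=> y; rewrite !akE; exact/ak_piP/acong_addC.
Qed.

Fact ak_add0 : left_id (ak_const 0) ak_add.
Proof. by elim/ak_ind=> x; rewrite !akE; exact/ak_piP/acong_add0. Qed.

Fact ak_addN : left_inverse (ak_const 0) (ak_mul (ak_const (-1))) ak_add.
Proof. by elim/ak_ind=> x; rewrite /ak_const !akE; exact/ak_piP/acong_addN. Qed.

HB.instance Definition _ :=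
  GRing.isZmodule.Build akAlg ak_addA ak_addC ak_add0 ak_addN.

Fact ak_mulA : associative ak_mul.
Proof.
elim/ak_ind=> x; elim/ak_ind=> y; elim/ak_ind=> z; rewrite /ak_const !akE.
exact/ak_piP/acong_mulA.
Qed.

Fact ak_mul1 : left_id (ak_const 1) ak_mul.
Proof. by elim/ak_ind=> x; rewrite /ak_const !akE; exact/ak_piP/acong_mul1. Qed.

Fact ak_constC c x : ak_mul (ak_const c) x = ak_mul x (ak_const c).
Proof. by elim/ak_ind: x => x; rewrite /ak_const !akE; exact/ak_piP/acong_constC. Qed.

Fact ak_mulr1 : right_id (ak_const 1) ak_mul.
Proof. by move=> x; rewrite -ak_constC ak_mul1. Qed.

Fact ak_mulDl : left_distributive ak_mul ak_add.
Proof.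
elim/ak_ind=> x; elim/ak_ind=> y; elim/ak_ind=> z; rewrite /ak_const !akE.
exact/ak_piP/acong_mulDl.
Qed.

Fact ak_mulDr : right_distributive ak_mul ak_add.
Proof.
elim/ak_ind=> x; elim/ak_ind=> y; elim/ak_ind=> z; rewrite /ak_const !akE.
exact/ak_piP/acong_mulDr.
Qed.

(* The one-dimensional representation T_0 |-> u_p, T_i |-> q separates 0, 1. *)
Definition ak_point (i : 'I_n) : k^o :=
  if i == 0%N :> nat then (if [pick p : 'I_e] is Some p then u p else 0) else q.

Fact ak_point_sound x y :
  ak_rel x y -> aeval ak_point x = aeval ak_point y.
Proof.
have pointS (i : 'I_n) : (0 < i)%N -> ak_point i = q.
  by rewrite lt0n /ak_point => /negPf ->.
have evalC c : aeval ak_point (AConst c) = c by exact: mulr1.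
case=> [i i0 e0|i i0|i j _ _|i j _|i j i0 ji].
- rewrite (big_morph (aeval ak_point) (id1 := 1) (op1 := *%R)) // !evalC.
  have [p pE] : exists p, ak_point i = u p.
    rewrite /ak_point i0 eqxx; case: pickP => [p _|]; first by exists p.
    by move=> /(_ (Ordinal e0)).
  rewrite (bigD1 p) //; set c := aeval _ (AAdd _ _).
  suff -> : c = 0 by exact: mul0r.
  by rewrite /c /= [_%:A]mulr1 pE; exact: (subrr (u p)).
- have c0 : aeval ak_point (AAdd (V i) (AConst (- q))) = 0; last first.
    by rewrite evalC [LHS](congr1 (fun c => c * _) c0) [LHS]mul0r.
  by rewrite /= [_%:A]mulr1 pointS //; exact: (subrr q).
- rewrite /=; set a := ak_point i; set b := ak_point j.
  by have := mulrAC (a * b : k) a b; rewrite [a * b : k]mulrC.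
- exact: (@mulrC k).
- by rewrite /= !pointS // ji.
Qed.

Fact ak_oner_neq0 : ak_const 1 != ak_const 0.
Proof.
apply/eqP => /ak_piP /(aeval_sound ak_point_sound) /=.
by rewrite scale1r scale0r => /eqP; rewrite oner_eq0.
Qed.

HB.instance Definition _ := GRing.Zmodule_isNzRing.Build akAlg
  ak_mulA ak_mul1 ak_mulr1 ak_mulDl ak_mulDr ak_oner_neq0.

Definition ak_scale (c : k) (x : akAlg) : akAlg := ak_const c * x.

Fact ak_constM a b : ak_const (a * b) = ak_const a * ak_const b.
Proof. by rewrite [RHS]akE; exact/ak_piP/acong_constM. Qed.

Fact ak_constD a b : ak_const (a + b) = ak_const a + ak_const b.
Proof. by rewrite [RHS]akE; exact/ak_piP/acong_constD. Qed.

Fact ak_scaleA a b x : ak_scale a (ak_scale b x) = ak_scale (a * b) x.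
Proof. by rewrite /ak_scale mulrA ak_constM. Qed.

Fact ak_scale1 : left_id 1 ak_scale.
Proof. by move=> x; rewrite /ak_scale [LHS]ak_mul1. Qed.

Fact ak_scaleDr : right_distributive ak_scale +%R.
Proof. by move=> c x y; rewrite /ak_scale mulrDr. Qed.

Fact ak_scaleDl x : {morph ak_scale^~ x : a b / a + b}.
Proof. by move=> a b; rewrite /ak_scale ak_constD mulrDl. Qed.

HB.instance Definition _ := GRing.Zmodule_isLmodule.Build k akAlg
  ak_scaleA ak_scale1 ak_scaleDr ak_scaleDl.

Fact ak_scaleAl a (x y : akAlg) : a *: (x * y) = (a *: x) * y.
Proof. exact: mulrA. Qed.

HB.instance Definition _ := GRing.Lmodule_isLalgebra.Build k akAlg ak_scaleAl.

Fact ak_scaleAr a (x y : akAlg) : a *: (x * y) = x * (a *: y).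
Proof.
rewrite [LHS]mulrA [RHS]mulrA; congr (_ * _); exact: ak_constC.
Qed.

HB.instance Definition _ := GRing.Lalgebra_isAlgebra.Build k akAlg ak_scaleAr.

Definition ak_inverse (x y : akAlg) := y * x = 1 /\ x * y = 1.
Definition ak_unit : pred akAlg := fun x => `[< exists y, ak_inverse x y >].
Definition ak_inv (x : akAlg) : akAlg :=
  if pselect (exists y, ak_inverse x y) is left h then sval (cid h) else x.

Fact ak_invP x : x \in ak_unit -> ak_inverse x (ak_inv x).
Proof.
move=> /asboolP xU; rewrite /ak_inv; case: pselect => // h.
exact: (svalP (cid h)).
Qed.

Fact ak_mulVr : {in ak_unit, left_inverse 1 ak_inv *%R}.
Proof. by move=> x /ak_invP []. Qed.

Fact ak_divrr : {in ak_unit, right_inverse 1 ak_inv *%R}.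
Proof. by move=> x /ak_invP []. Qed.

Fact ak_unitrP x y : y * x = 1 /\ x * y = 1 -> ak_unit x.
Proof. by move=> xy; apply/asboolP; exists y. Qed.

Fact ak_invr_out : {in [predC ak_unit], ak_inv =1 id}.
Proof.
by move=> x /asboolP xU; rewrite /ak_inv; case: pselect.
Qed.

HB.instance Definition _ := GRing.NzRing_hasMulInverse.Build akAlg
  ak_mulVr ak_divrr ak_unitrP ak_invr_out.

(* T_i for i < n; the value 1 at i >= n is never used. *)
Definition akT (i : nat) : akAlg :=
  if insub i is Some j then pi (V j) else 1.

Lemma akTE (i : 'I_n) : akT i = pi (V i).
Proof. by rewrite /akT valK. Qed.

(* The algebra morphism T_i |-> f i, when f satisfies the relations. *)
Definition ak_lift (B : algType k) (f : 'I_n -> B) (x : akAlg) : B :=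
  aeval f (repr x).

Lemma ak_liftE (B : algType k) (f : 'I_n -> B) :
    (forall x y, ak_rel x y -> aeval f x = aeval f y) ->
  forall x, ak_lift f (pi x) = aeval f x.
Proof. by move=> fR x; apply: (aeval_sound fR); apply: ak_reprP. Qed.

Lemma aeval_akT x : aeval (fun i : 'I_n => akT i) x = pi x.
Proof.
elim: x => [i|c|x IHx y IHy|x IHx y IHy] /=; rewrite ?IHx ?IHy.
- exact: akTE.
- exact: mulr1.
- exact: ak_addE.
- exact: ak_mulE.
Qed.

Lemma akT_cyclotomic : (0 < n)%N -> (0 < e)%N ->
  \prod_(p < e) (akT 0 - (u p)%:A) = 0.
Proof.
move=> n0 e0; pose i := Ordinal n0.
have /ak_piP : acong ak_rel _ _ := acong_rel (AK_cyclotomic (i := i) erefl e0).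
rewrite -!aeval_akT /= scale0r => <-.
rewrite (big_morph (aeval _) (id1 := 1) (op1 := *%R)) //=; last exact: scale1r.
by apply: eq_bigr => p _; rewrite scaleNr.
Qed.

Lemma akT_quadratic i : (0 < i < n)%N -> (akT i - q%:A) * (akT i + 1) = 0.
Proof.
move=> /andP[i0 ni]; pose j := Ordinal ni.
have /ak_piP := acong_rel (@AK_quadratic j i0).
by rewrite -!aeval_akT /= scale0r scaleNr scale1r.
Qed.

Lemma akT_braid4 : (1 < n)%N ->
  akT 0 * akT 1 * akT 0 * akT 1 = akT 1 * akT 0 * akT 1 * akT 0.
Proof.
move=> n1; have n0 : (0 < n)%N := ltnW n1.
have /ak_piP := acong_rel (@AK_braid4 (Ordinal n0) (Ordinal n1) erefl erefl).
by rewrite -!aeval_akT.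
Qed.

Lemma akT_comm i j : (i.+1 < j < n)%N -> akT i * akT j = akT j * akT i.
Proof.
move=> /andP[ij nj]; have ni : (i < n)%N by apply: ltn_trans nj; apply: ltnW.
have /ak_piP := acong_rel (@AK_comm (Ordinal ni) (Ordinal nj) ij).
by rewrite -!aeval_akT.
Qed.

Lemma akT_braid3 i : (0 < i)%N -> (i.+1 < n)%N ->
  akT i * akT i.+1 * akT i = akT i.+1 * akT i * akT i.+1.
Proof.
move=> i0 ni1; have ni : (i < n)%N := ltnW ni1.
have /ak_piP := acong_rel (@AK_braid3 (Ordinal ni) (Ordinal ni1) i0 erefl).
by rewrite -!aeval_akT.
Qed.

Fixpoint akL (i : nat) : akAlg :=
  if i is i'.+1 then akT i * akL i' * (akT i)^-1 else akT 0.

End ArikiKoike.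

Section Inclusion.
Variables (k : fieldType) (e : nat) (q : k) (u : 'I_e -> k) (n : nat).

(* The canonical map from H_{e,n} to H_{e,n+1}. *)
Definition ak_incl : akAlg q u n -> akAlg q u n.+1 :=
  ak_lift (fun i : 'I_n => akT q u n.+1 i).

Lemma ak_incl_sound x y : ak_rel q u x y ->
  aeval (fun i : 'I_n => akT q u n.+1 i) x =
  aeval (fun i : 'I_n => akT q u n.+1 i) y.
Proof.
case=> [i i0 e0|i i0|i j i0 j1|i j ij|i j i0 ji] /=.
- rewrite (big_morph (aeval _) (id1 := 1) (op1 := *%R)) //=; last first.
    exact: scale1r.
  rewrite scale0r -[RHS](akT_cyclotomic q u (isT : 0 < n.+1)%N e0) i0.
  by apply: eq_bigr => p _; rewrite scaleNr.
- rewrite scale0r scaleNr scale1r akT_quadratic //.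
  by rewrite i0 ltnS ltnW.
- by rewrite i0 j1 akT_braid4 // ltnS (leq_ltn_trans (leq0n j)).
- by rewrite akT_comm // ij ltnS ltnW.
- by rewrite ji akT_braid3 // -ji ltnS ltnW.
Qed.

End Inclusion.

Section GroupTerms.
Variable I : Type.

Inductive gterm :=
| GVar of I
| GOne
| GMul of gterm & gterm
| GInv of gterm.

HB.instance Definition _ := gen_eqMixin gterm.
HB.instance Definition _ := gen_choiceMixin gterm.

Inductive gcong (R : gterm -> gterm -> Prop) : gterm -> gterm -> Prop :=
| gcong_rel x y : R x y -> gcong R x y
| gcong_refl x : gcong R x x
| gcong_sym x y : gcong R x y -> gcong R y x
| gcong_trans y x z : gcong R x y -> gcong R y z -> gcong R x z
| gcong_mul x x' y y' :
    gcong R x x' -> gcong R y y' -> gcong R (GMul x y) (GMul x' y')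
| gcong_inv x x' : gcong R x x' -> gcong R (GInv x) (GInv x')
| gcong_mulA x y z : gcong R (GMul x (GMul y z)) (GMul (GMul x y) z)
| gcong_mul1 x : gcong R (GMul GOne x) x
| gcong_mulr1 x : gcong R (GMul x GOne) x
| gcong_mulV x : gcong R (GMul (GInv x) x) GOne
| gcong_mulrV x : gcong R (GMul x (GInv x)) GOne.

Definition gcongb R x y : bool := `[< gcong R x y >].

Lemma gcongb_refl R : reflexive (gcongb R).
Proof. by move=> x; apply/asboolP/gcong_refl. Qed.

Lemma gcongb_sym R : ssrbool.symmetric (gcongb R).
Proof.
by move=> x y; apply/idP/idP => /asboolP h; apply/asboolP; apply: gcong_sym.
Qed.

Lemma gcongb_trans R : transitive (gcongb R).
Proof.
by move=> y x z /asboolP h /asboolP h'; apply/asboolP; apply: gcong_trans h'.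
Qed.

Definition gcong_equiv R : equiv_rel gterm :=
  EquivRel (gcongb R) (@gcongb_refl R) (@gcongb_sym R) (@gcongb_trans R).

End GroupTerms.

Arguments GOne {I}.

Fixpoint geval (I B : Type) (one : B) (mul : B -> B -> B) (inv : B -> B)
    (f : I -> B) (x : gterm I) : B :=
  match x with
  | GVar i => f i
  | GOne => one
  | GMul x y => mul (geval one mul inv f x) (geval one mul inv f y)
  | GInv x => inv (geval one mul inv f x)
  end.

Section AffineBraidGroup.
Variable n : nat.

Local Notation V i := (GVar (i : 'I_n)).
Local Notation "x ** y" := (GMul x y) (at level 40, left associativity).

Inductive braid_rel : gterm 'I_n -> gterm 'I_n -> Prop :=
| B_braid4 (i j : 'I_n) : i = 0%N :> nat -> j = 1%N :> nat ->
    braid_rel (V i ** V j ** V i ** V j) (V j ** V i ** V j ** V i)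
| B_comm (i j : 'I_n) : (i.+1 < j)%N -> braid_rel (V i ** V j) (V j ** V i)
| B_braid3 (i j : 'I_n) : (0 < i)%N -> j = i.+1 :> nat ->
    braid_rel (V i ** V j ** V i) (V j ** V i ** V j).

Definition affBraid := {eq_quot gcong_equiv braid_rel}.

HB.instance Definition _ := Choice.on affBraid.
HB.instance Definition _ := EqQuotient.on affBraid.

Local Notation pi x := (\pi_affBraid x).

Lemma br_piP (x y : gterm 'I_n) : pi x = pi y <-> gcong braid_rel x y.
Proof.
split=> [/eqP|h]; first by rewrite piE => /asboolP.
by apply/eqP; rewrite piE; apply/asboolP.
Qed.

Lemma br_reprP (x : gterm 'I_n) : gcong braid_rel (repr (pi x)) x.
Proof. by apply/br_piP; rewrite reprK. Qed.

Lemma br_ind (P : affBraid -> Prop) : (forall x, P (pi x)) -> forall x, P x.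
Proof. by move=> h x; rewrite -[x]reprK. Qed.

Definition br_mul (x y : affBraid) : affBraid := pi (repr x ** repr y).
Definition br_inv (x : affBraid) : affBraid := pi (GInv (repr x)).
Definition br_one : affBraid := pi GOne.

Lemma br_mulE x y : br_mul (pi x) (pi y) = pi (x ** y).
Proof. by apply/br_piP; apply: gcong_mul; apply: br_reprP. Qed.

Lemma br_invE x : br_inv (pi x) = pi (GInv x).
Proof. by apply/br_piP; apply: gcong_inv; apply: br_reprP. Qed.

Let brE := (br_mulE, br_invE).

Fact br_mulA : associative br_mul.
Proof.
elim/br_ind=> x; elim/br_ind=> y; elim/br_ind=> z; rewrite !brE.
exact/br_piP/gcong_mulA.
Qed.

Fact br_mul1 : left_id br_one br_mul.
Proof. by elim/br_ind=> x; rewrite !brE; exact/br_piP/gcong_mul1. Qed.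

Fact br_mulr1 : right_id br_one br_mul.
Proof. by elim/br_ind=> x; rewrite !brE; exact/br_piP/gcong_mulr1. Qed.

Fact br_mulV : left_inverse br_one br_inv br_mul.
Proof. by elim/br_ind=> x; rewrite !brE; exact/br_piP/gcong_mulV. Qed.

Fact br_mulrV : right_inverse br_one br_inv br_mul.
Proof. by elim/br_ind=> x; rewrite !brE; exact/br_piP/gcong_mulrV. Qed.

HB.instance Definition _ :=
  isGroup.Build affBraid br_mulA br_mul1 br_mulr1 br_mulV br_mulrV.

Definition br_gen (i : 'I_n) : affBraid := pi (GVar i).

(* The writhe of the closure: the exponent sum in t_1, ..., t_{n-1}.  The
   crossings of t_0 are with the fixed cylinder and are not counted. *)
Definition writhe (alpha : affBraid) : int :=
  @geval _ int 0 +%R -%R (fun i : 'I_n => if i == 0%N :> nat then 0 else 1)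
    (repr alpha).

End AffineBraidGroup.

Section Writhe.
Variable n : nat.

Let wr :=
  @geval _ int 0 +%R -%R (fun i : 'I_n => if i == 0%N :> nat then 0 else 1).

Lemma writhe_pi x : writhe (\pi_(affBraid n) x) = wr x.
Proof.
rewrite /writhe /wr; move: (repr _) (br_reprP x) => y; elim=> //= {x y}.
- move=> x y [i j i0 j1|i j _|i j i0 ji] /=.
  + by rewrite i0 j1.
  + by rewrite addrC.
  + by rewrite ji eqn0Ngt i0.
- by move=> y x z _ -> _ ->.
- by move=> x x' y y' _ -> _ ->.
- by move=> x x' _ ->.
- by move=> x y z; rewrite addrA.
- by move=> x; rewrite add0r.
- by move=> x; rewrite addr0.
- by move=> x; rewrite addNr.
- by move=> x; rewrite addrN.
Qed.

Lemma writheM (a b : affBraid n) : writhe (a * b)%g = writhe a + writhe b.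
Proof.
elim/br_ind: a => x; elim/br_ind: b => y.
by rewrite [(_ * _)%g]br_mulE !writhe_pi.
Qed.

End Writhe.

Section BraidToAlgebra.
Variables (k : fieldType) (e : nat) (q : k) (u : 'I_e -> k) (n : nat).

Definition br_to_ak (alpha : affBraid n) : akAlg q u n :=
  geval 1 *%R GRing.inv (fun i : 'I_n => akT q u n i) (repr alpha).

Hypotheses (e_gt0 : (0 < e)%N) (q_neq0 : q != 0) (u_neq0 : forall p, u p != 0).

Lemma akT_unit i : (i < n)%N -> akT q u n i \is a GRing.unit.
Proof.
have scaled_unit (c : k) (x y : akAlg q u n) :
    c != 0 -> x * y = c%:A -> y * x = c%:A -> x \is a GRing.unit.
  move=> c0 xy yx; apply/unitrP; exists (c^-1 *: y).
  by rewrite -scalerAl -scalerAr xy yx scalerA mulVf // scale1r.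
case: i => [|i] ni.
  have [y [xy yx]] : exists y : akAlg q u n,
      akT q u n 0 * y = (- \prod_(p < e) - u p)%:A /\
      y * akT q u n 0 = (- \prod_(p < e) - u p)%:A.
    have := akT_cyclotomic q u ni e_gt0.
    set x := akT q u n 0; set P := \prod_(p < e) (_ - _) => P0.
    suff [y [xy yx]] : exists y, P = x * y + (\prod_(p < e) - u p)%:A /\
        x * y = y * x.
      exists y; rewrite -yx scaleNr; split; apply/eqP;
      by rewrite -addr_eq0 -xy P0.
    rewrite /P; elim/big_rec2: _ => [|p a b _ [y [-> yx]]].
      by exists 0; rewrite mulr0 mul0r add0r scale1r.
    have cx : (x - (u p)%:A) * x = x * (x - (u p)%:A).
      by rewrite mulrBl mulrBr mulr_algl mulr_algr.
    exists ((x - (u p)%:A) * y + a%:A); split.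
      rewrite !mulrDr [_ * (x * y)]mulrA cx -mulrA -addrA; congr (_ + _).
      by rewrite mulrBl mulr_algl scalerA mulNr scaleNr.
    rewrite [LHS]mulrDr [RHS]mulrDl mulr_algr mulr_algl; congr (_ + _).
    by rewrite mulrA -cx -!mulrA yx.
  apply: scaled_unit xy yx; rewrite oppr_eq0.
  by apply/prodf_neq0 => p _; rewrite oppr_eq0.
have := @akT_quadratic _ _ q u n i.+1 ni; set x := akT q u n _ => xE.
have yx : (x + (1 - q)%:A) * x = q%:A.
  apply/eqP; rewrite -subr_eq0 -[X in _ == X]xE; apply/eqP.
  rewrite mulrDl mulr_algl scalerBl scale1r.
  by rewrite mulrBl mulrDr mulr1 mulr_algl scalerDr opprD !addrA.
apply: scaled_unit q_neq0 _ (yx); rewrite -yx [LHS]mulrDr [RHS]mulrDl.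
by rewrite mulr_algl mulr_algr.
Qed.

Let ev := geval 1 *%R GRing.inv (fun i : 'I_n => akT q u n i).

Let ev_unit x : ev x \is a GRing.unit.
Proof.
elim: x => [i||x xU y yU|x xU] /=.
- exact: akT_unit.
- exact: unitr1.
- by rewrite unitrMl.
- by rewrite unitrV.
Qed.

Lemma br_to_ak_pi x : br_to_ak (\pi_(affBraid n) x) = ev x.
Proof.
rewrite /br_to_ak /ev; move: (repr _) (br_reprP x) => y; elim=> //= {x y}.
- move=> x y [i j i0 j1|i j ij|i j i0 ji] /=.
  + by rewrite i0 j1 akT_braid4 // -j1.
  + by rewrite akT_comm // ij ltn_ord.
  + by rewrite ji akT_braid3 // -ji.
- by move=> y x z _ -> _ ->.
- by move=> x x' y y' _ -> _ ->.
- by move=> x x' _ ->.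
- by move=> x y z; rewrite mulrA.
- by move=> x; rewrite mul1r.
- by move=> x; rewrite mulr1.
- by move=> x; rewrite mulVr.
- by move=> x; rewrite divrr.
Qed.

Lemma br_to_ak_unit a : br_to_ak a \is a GRing.unit.
Proof. by elim/br_ind: a => x; rewrite br_to_ak_pi ev_unit. Qed.

Lemma br_to_akM a b : br_to_ak (a * b)%g = br_to_ak a * br_to_ak b.
Proof.
elim/br_ind: a => x; elim/br_ind: b => y.
by rewrite [(_ * _)%g]br_mulE !br_to_ak_pi.
Qed.

Lemma br_to_ak_gen i : br_to_ak (br_gen i) = akT q u n i.
Proof. exact: br_to_ak_pi. Qed.

End BraidToAlgebra.

Section MarkovTrace.
Variables (k : fieldType) (e : nat) (q : k) (u : 'I_e -> k).
Variables (R : comNzRingType) (emb : k -> R) (z : R) (y : nat -> R).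

(* A linear map on the union H_e is a family of linear maps on the H_{e,n}
   compatible with the inclusions.  The two Markov conditions relate H_{e,n}
   to H_{e,n+1}; for n = 0 the second one reads tau (T_0 ^ j) = y_j.  Only
   y_1, ..., y_{e-1} occur. *)
Record is_markov_trace (tau : forall n, akAlg q u n -> R) : Prop := {
  markov_linear : forall n (c : k) (h h' : akAlg q u n),
    tau n (c *: h + h') = emb c * tau n h + tau n h';
  markov_incl : forall n (h : akAlg q u n), tau n.+1 (ak_incl h) = tau n h;
  markov_one : forall n, tau n 1 = 1;
  markov_comm : forall n (h h' : akAlg q u n), tau n (h * h') = tau n (h' * h);
  markov_T : forall n (h : akAlg q u n), (0 < n)%N ->
    tau n.+1 (ak_incl h * akT q u n.+1 n) = z * tau n h;
  markov_L : forall n (h : akAlg q u n) j, (0 < j < e)%N ->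
    tau n.+1 (ak_incl h * akL q u n.+1 n ^+ j) = y j * tau n h
}.

End MarkovTrace.

Section Tableaux.

(* A tableau is recorded by the box (row, column) of each of its n entries,
   rows, columns and entries being numbered from 0. *)
Definition tableau n := {ffun 'I_n -> 'I_n * 'I_n}.

Definition is_standard n (lam : seq nat) (t : tableau n) : bool :=
  [&& injectiveb t,
      [forall b : 'I_n * 'I_n, (b \in codom t) == (b.2 < nth 0%N lam b.1)%N],
      [forall i, forall j,
         ((t i).1 == (t j).1) && ((t i).2 < (t j).2)%N ==> (i < j)%N]
    & [forall i, forall j,
         ((t i).2 == (t j).2) && ((t i).1 < (t j).1)%N ==> (i < j)%N]].

Definition std_tableau n (lam : seq nat) := {t : tableau n | is_standard lam t}.

Definition content n (t : tableau n) (i : 'I_n) : int :=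
  (t i).2%:Z - (t i).1%:Z.

Definition exchange n (i j : 'I_n) (t : tableau n) : tableau n :=
  [ffun m => t (tperm i j m)].

Definition hook n (a : nat) : seq nat := a.+1 :: nseq (n - a.+1) 1%N.

End Tableaux.

Section HookCharacters.
Variables (k : fieldType) (e : nat) (q : k) (u : 'I_e -> k) (n : nat).

(* Coefficient of s in the image of t under the generator exchanging the
   consecutive entries i and j = i + 1.  In a standard tableau, adjacent
   means that j is immediately to the right of, resp. below, i. *)
Definition tab_coef (i j : 'I_n) (s t : tableau n) : k :=
  if ((t i).1 == (t j).1) && ((t i).2.+1 == (t j).2 :> nat) then
    q * (s == t)%:R
  else if ((t i).2 == (t j).2) && ((t i).1.+1 == (t j).1 :> nat) then
    - (s == t)%:R
  else
    let d := content t i - content t j in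
    (1 - q ^ d)^-1 *
      ((q - 1) * (s == t)%:R + q * (1 - q ^ (d - 1)) * (s == exchange i j t)%:R).

Definition tab_mx (lam : seq nat) (i j : 'I_n) :
    'M[k]_#|{: std_tableau n lam}| :=
  \matrix_(s, t) tab_coef i j (val (enum_val s)) (val (enum_val t)).

Definition is_representation d (rho : akAlg q u n -> 'M[k]_d) : Prop :=
  [/\ linear rho, rho 1 = 1%:M & forall x y, rho (x * y) = rho x *m rho y].

(* Entries being numbered from 0, the generator T_j exchanges j - 1 and j. *)
Definition is_hook_character (a : 'I_n) (p : 'I_e)
    (chi : akAlg q u n -> k) : Prop :=
  exists rho : akAlg q u n -> 'M[k]_#|{: std_tableau n (hook n a)}|,
    [/\ is_representation rho,
        rho (akT q u n 0) = (u p)%:M,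
        forall i j : 'I_n, j = i.+1 :> nat ->
          rho (akT q u n j) = tab_mx (hook n a) i j
      & forall x, chi x = \tr (rho x)].

End HookCharacters.

Section BaseField.
Variable e : nat.

Definition akField : fieldType := {fraction {mpoly rat[e.+1]}}.

Definition ak_q : akField := tofrac ('X_ord0 : {mpoly rat[e.+1]}).
Definition ak_u (p : 'I_e) : akField :=
  tofrac ('X_(lift ord0 p) : {mpoly rat[e.+1]}).

End BaseField.

Notation akH e := (@akAlg (akField e) e (ak_q e) (@ak_u e)).

Section Invariants.
Variables (e : nat) (K : fieldType) (iota : akField e -> K).

(* K is an extension of the base field containing the parameters y_j, and
   K(t^(1/2)) is its field of rational functions in one variable. *)
Definition ratfun : fieldType := {fraction {poly K}}.

Definition ratfun_const (c : K) : ratfun := tofrac c%:P.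
Definition sqrt_t : ratfun := tofrac ('X : {poly K}).
Definition var_t : ratfun := sqrt_t ^+ 2.
Definition emb_K (c : akField e) : ratfun := ratfun_const (iota c).

Definition var_z : ratfun :=
  - ((1 - emb_K (ak_q e)) / (1 - var_t * emb_K (ak_q e))).

Definition homflypt (tau : forall n, akH e n -> ratfun) n (alpha : affBraid n)
    : ratfun :=
  (- ((1 - var_t * emb_K (ak_q e)) / (sqrt_t * (1 - emb_K (ak_q e))))) ^+ n.-1
  * sqrt_t ^ writhe alpha * tau n (br_to_ak (ak_q e) (@ak_u e) alpha).

(* The rational function f is defined at x, with value c. *)
Definition evaluates_to (f : ratfun) (x c : K) : Prop :=
  exists num den : {poly K},
    [/\ den.[x] != 0, f = tofrac num / tofrac den & c = num.[x] / den.[x]].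

Lemma evaluates_to_unique f x c c' :
  evaluates_to f x c -> evaluates_to f x c' -> c = c'.
Proof.
move=> [n1 [d1 [d1x -> ->]]] [n2 [d2 [d2x E ->]]].
have nz (d : {poly K}) : d.[x] != 0 -> tofrac d != 0.
  by move=> dx; rewrite tofrac_eq0; apply: contraNneq dx => ->; rewrite horner0.
move/eqP: E; rewrite eqr_div ?nz // -!tofracM tofrac_eq => /eqP E.
by apply/eqP; rewrite eqr_div // -!hornerM E.
Qed.

(* t = q^-1 means t^(1/2) = sqrt_q^-1, for the chosen square root of q. *)
Definition alexander_is (sqrt_q : K) (tau : forall n, akH e n -> ratfun) n
    (alpha : affBraid n) (c : K) : Prop :=
  evaluates_to (homflypt tau alpha) sqrt_q^-1 c.

Definition sigma (d : nat) : K := (mesym e K d).@[fun p => iota (ak_u p)].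

(* hook_weight p divided by the product of the u_p - u_l (l <> p) is the value
   of the trace at the idempotent of H_{e,1} on which T_0 acts by u_p. *)
Definition hook_weight (y : nat -> K) (p : 'I_e) : K :=
  \sum_(1 <= i < e)
     (iota (ak_u p) ^+ (e - i - 1) *
      \sum_(1 <= j < i.+1) (-1) ^+ (i - j) * y j * sigma (i - j))
  + (-1) ^+ e.-1 * \prod_(l < e | l != p) iota (ak_u l).

End Invariants.

(* Main.v *)
(* At t = 1/q the parameter z becomes infinite, so only the part of degree n - 1
   in z of the Markov trace on H_n contributes.  Since
   H_{n+1} = H_n T_n H_n + sum_{j < e} H_n L_n^j, this leading part phi_n is
   determined by phi_1 and by phi_{n+1}(h T_n h') = phi_n(h' h) and
   phi_{n+1}(h L_n^j) = 0.

   The alternating sum of the hook characters satisfies the same recursion, up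
   to a scalar.  A hook tableau of size n is the set of those of its entries
   lying in the arm, and for given p the matrix of T_i on the sum of all the
   hook modules only involves i and the positions of its two entries.  The
   last entry is in the arm or in the leg, with opposite signs: hence the sum
   vanishes on H_n, and on h T_n it is the sum on h times the difference of two
   diagonal coefficients of T_n, which is - (1 - q^(n+1)) / (1 - q^n) in all
   cases.  Moreover L_n, a conjugate of T_0, acts by the scalar u_p.  On H_1 the
   formula is Lagrange interpolation at u_1, ..., u_e.

   Only the hook modules of the given size are available; those of smaller size
   are obtained from them by restriction, fixing the positions of the last
   entries. *)
Require Import Defs.
From mathcomp Require Import all_boot all_order all_algebra generic_quotient.
From mathcomp Require Import perm boolp.
From mathcomp Require Import mpoly.
From mathcomp Require Import ring zify.
From HB Require Import structures.

Set Implicit Arguments.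
Unset Strict Implicit.
Unset Printing Implicit Defensive.

Import GRing.Theory.
Local Open Scope ring_scope.
Local Open Scope quotient_scope.

(** * The tower of Ariki-Koike algebras *)

Lemma conj_expr (A : unitRingType) (t x : A) j :
  t \is a GRing.unit -> (t * x * t^-1) ^+ j = t * x ^+ j * t^-1.
Proof.
move=> tU; elim: j => [|j IHj]; first by rewrite !expr0 mulr1 divrr.
by rewrite exprS IHj exprS !mulrA mulrVK.
Qed.

(** The polynomial with roots [u p] is monic of degree [e] and kills [x]; the coefficients are those
    of the remainder of ['X^j] modulo it. *)
Lemma alg_expr_reduce (k : fieldType) (A : algType k) (e : nat)
    (u : 'I_e -> k) (x : A) :
    \prod_(p < e) (x - (u p)%:A) = 0 ->
  forall j, exists c : 'I_e -> k, x ^+ j = \sum_(i < e) c i *: x ^+ i.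
Proof.
move=> x0 j; pose P : {poly k} := \prod_(p < e) ('X - (u p)%:P).
have P0 : horner_alg x P = 0.
  rewrite rmorph_prod -[RHS]x0; apply: eq_bigr => p _.
  by rewrite rmorphB /= horner_algX horner_algC.
have szP : size P = e.+1.
  by rewrite size_prod_XsubC /index_enum -enumT size_enum_ord.
have szr : (size ('X^j %% P)%R <= e)%N.
  by rewrite -ltnS -szP ltn_modp -size_poly_gt0 szP.
exists (fun i : 'I_e => ('X^j %% P)`_i).
have -> : x ^+ j = horner_alg x 'X^j by rewrite rmorphXn /= horner_algX.
rewrite {1}(divp_eq 'X^j P) rmorphD rmorphM /= P0 mulr0 add0r.
have {1}-> : 'X^j %% P = \sum_(i < e) ('X^j %% P)`_i *: 'X^i.
  rewrite -poly_def; apply/polyP => i; rewrite coef_poly; case: ltnP => // ei.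
  by rewrite nth_default // (leq_trans szr).
rewrite rmorph_sum; apply: eq_bigr => i _.
by rewrite -mul_polyC rmorphM rmorphXn /= horner_algC horner_algX mulr_algl.
Qed.

Section Tower.
Variables (k : fieldType) (e : nat) (q : k) (u : 'I_e -> k).

Local Notation H := (akAlg q u).
Local Notation T := (akT q u).
Local Notation L := (akL q u).

Lemma ak_addpi n x y : \pi_(H n) x + \pi_(H n) y = \pi_(H n) (AAdd x y).
Proof. exact: ak_addE. Qed.

Lemma ak_mulpi n x y : \pi_(H n) x * \pi_(H n) y = \pi_(H n) (AMul x y).
Proof. exact: ak_mulE. Qed.

Lemma ak_constpi n c : c%:A = \pi_(H n) (AConst c).
Proof. exact: mulr1. Qed.

Lemma ak_incl_pi n (x : aterm k 'I_n) :
  ak_incl (\pi_(H n) x) = aeval (fun i : 'I_n => T n.+1 i) x.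
Proof. exact: (ak_liftE (@ak_incl_sound _ _ _ _ _)). Qed.

Fact ak_incl_linear n : linear (@ak_incl k e q u n).
Proof.
move=> c; elim/ak_ind=> x; elim/ak_ind=> y.
rewrite -mulr_algl ak_constpi ak_mulpi ak_addpi !ak_incl_pi /=.
by rewrite mulr_algl.
Qed.

Fact ak_incl_monoid_morphism n : monoid_morphism (@ak_incl k e q u n).
Proof.
split=> [|]; first by rewrite -[1]scale1r ak_constpi ak_incl_pi /= scale1r.
by elim/ak_ind=> x; elim/ak_ind=> y; rewrite ak_mulpi !ak_incl_pi.
Qed.

HB.instance Definition _ n := GRing.isLinear.Build k (H n) (H n.+1) *:%R
  (@ak_incl k e q u n) (@ak_incl_linear n).
HB.instance Definition _ n := GRing.isMonoidMorphism.Build (H n) (H n.+1)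
  (@ak_incl k e q u n) (@ak_incl_monoid_morphism n).

Lemma ak_incl_alg n c : ak_incl (c%:A : H n) = c%:A.
Proof. by rewrite linearZ_LR rmorph1. Qed.

Lemma ak_incl_T n i : (i < n)%N -> ak_incl (T n i) = T n.+1 i.
Proof.
by move=> ni; rewrite (akTE q u (Ordinal ni)) ak_incl_pi.
Qed.

Lemma ak_gen_ind n (P : H n -> Prop) :
    (forall c, P c%:A) -> (forall i, (i < n)%N -> P (T n i)) ->
    (forall x y, P x -> P y -> P (x + y)) ->
    (forall x y, P x -> P y -> P (x * y)) ->
  forall x, P x.
Proof.
move=> Pc PT PD PM; elim/ak_ind; elim=> [i|c|x IHx y IHy|x IHx y IHy].
- by rewrite -akTE; apply: PT.
- by rewrite -ak_constpi.
- by rewrite -ak_addpi; apply: PD.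
- by rewrite -ak_mulpi; apply: PM.
Qed.

Hypotheses (e_gt0 : (0 < e)%N) (q_neq0 : q != 0) (u_neq0 : forall p, u p != 0).

Let TU n i : (i < n)%N -> T n i \is a GRing.unit.
Proof. exact: akT_unit. Qed.

Lemma akLS n i : L n i.+1 = T n i.+1 * L n i * (T n i.+1)^-1.
Proof. by []. Qed.

Lemma ak_incl_L n i : (i < n)%N -> ak_incl (L n i) = L n.+1 i.
Proof.
elim: i => [|i IHi] ni; rewrite /= ?ak_incl_T //.
by rewrite !rmorphM rmorphV ?TU //= ak_incl_T // IHi // ltnW.
Qed.

Lemma akT_sqr n i : (0 < i < n)%N ->
  T n i * T n i = (q - 1) *: T n i + q%:A.
Proof.
move=> /(@akT_quadratic _ _ q u n i) /eqP.
rewrite mulrBl mulrDr mulr1 mulr_algl scalerDr subr_eq0 => /eqP E.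
by rewrite scalerBl scale1r -[in RHS]addrA [- _ + _]addrC addrA -E addrK.
Qed.

Lemma akT_inv n i : (0 < i < n)%N ->
  (T n i)^-1 = q^-1 *: (T n i - (q - 1)%:A).
Proof.
move=> ni; have nU : T n i \is a GRing.unit by case/andP: ni => _ /TU.
apply: (mulrI nU); rewrite divrr // -scalerAr mulrBr akT_sqr // mulr_algr.
by rewrite addrC addKr scalerA mulVf // scale1r.
Qed.

Lemma akT_divr n i x : (0 < i < n)%N ->
  x * (T n i)^-1 = q^-1 *: (x * T n i - (q - 1) *: x).
Proof. by move=> ni; rewrite akT_inv // -scalerAr mulrBr mulr_algr. Qed.

(** The algebra H_n is generated by the T_i with i < n, all at distance at least two from n + 1. *)
Lemma akT_incl_comm n (h : H n) : T n.+2 n.+1 * ak_incl (ak_incl h) =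
  ak_incl (ak_incl h) * T n.+2 n.+1.
Proof.
elim/ak_gen_ind: h => [c|i ni|x y Ex Ey|x y Ex Ey].
- by rewrite !ak_incl_alg mulr_algl mulr_algr.
- rewrite (ak_incl_T ni) (ak_incl_T (ltnW ni : (i < n.+1)%N)).
  by apply/esym/akT_comm; rewrite !ltnS ni /=.
- by rewrite !rmorphD mulrDl mulrDr Ex Ey.
- by rewrite !rmorphM mulrA Ex -mulrA Ey mulrA.
Qed.

Lemma akL_conj n j :
  L n.+2 n.+1 ^+ j = T n.+2 n.+1 * ak_incl (L n.+1 n ^+ j) * (T n.+2 n.+1)^-1.
Proof. by rewrite conj_expr ?TU //= rmorphXn /= ak_incl_L. Qed.

Lemma akL_T n j :
  L n.+2 n.+1 ^+ j * T n.+2 n.+1 = T n.+2 n.+1 * ak_incl (L n.+1 n ^+ j).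
Proof. by rewrite akL_conj mulrVK ?TU. Qed.

(** Each L is a conjugate of the previous one, the first being T_0, so the cyclotomic relation is
    transported along the tower. *)
Lemma akL_cyclotomic n : \prod_(p < e) (L n.+1 n - (u p)%:A) = 0.
Proof.
elim: n => [|n IHn]; first exact: akT_cyclotomic.
pose t := T n.+2 n.+1; have tU : t \is a GRing.unit by exact: TU.
have conj_prod (s : seq 'I_e) : \prod_(p <- s) (L n.+2 n.+1 - (u p)%:A) =
    t * ak_incl (\prod_(p <- s) (L n.+1 n - (u p)%:A)) * t^-1.
  elim: s => [|p s IHs]; first by rewrite !big_nil rmorph1 mulr1 divrr.
  rewrite !big_cons IHs rmorphM rmorphB /= ak_incl_L // ak_incl_alg.
  rewrite mulrBl [in RHS]mulrBl mulrBr mulrBl; congr (_ - _).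
    by rewrite -/t !mulrA mulrVK.
  by rewrite !mulr_algl -scalerAr -scalerAl.
by rewrite conj_prod IHn rmorph0 mulr0 mul0r.
Qed.

Lemma ak1_span (x : H 1) :
  exists c : 'I_e -> k, x = \sum_(i < e) c i *: T 1 0 ^+ i.
Proof.
have red := alg_expr_reduce (akL_cyclotomic 0).
elim/ak_gen_ind: x => [c|i|x y [c ->] [d ->]|x y [c ->] [d ->]].
- have [d d1] := red 0%N; exists (fun i => c * d i).
  by rewrite -[1]/(L 1 0 ^+ 0) d1 scaler_sumr; under eq_bigr do rewrite scalerA.
- by case: i => // _; have [d d1] := red 1%N; exists d.
- exists (fun i => c i + d i).
  by rewrite -big_split; under [RHS]eq_bigr do rewrite scalerDl.
(* The product of two combinations involves exponents [i + j] beyond the allowed range; [f] gives a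
   reduction for each of them. *)
have /choice [f fE] := red.
exists (fun l => \sum_(i < e) \sum_(j < e) c i * d j * f (i + j)%N l).
rewrite mulr_suml; under [LHS]eq_bigr => i _ do
  [rewrite mulr_sumr; under eq_bigr => j _ do
    rewrite -scalerAl -scalerAr scalerA -exprD (fE (i + j)%N : _ = _)
      scaler_sumr].
under [RHS]eq_bigr do [rewrite scaler_suml;
  under eq_bigr do rewrite scaler_suml].
rewrite [RHS]exchange_big; apply: eq_bigr => i _; rewrite [RHS]exchange_big.
by apply: eq_bigr => j _; apply: eq_bigr => l _; rewrite scalerA.
Qed.

(** The two families are those on which the Markov conditions can be read: cyclicity brings the
    first to the form [h' h T], and the powers of [L] stand on the right with exponents below
    [e]. *)
Inductive tower_span n : H n.+2 -> Prop :=
| tower_span_T (h h' : H n.+1) :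
    tower_span (ak_incl h * T n.+2 n.+1 * ak_incl h')
| tower_span_L (h : H n.+1) j :
    (j < e)%N -> tower_span (ak_incl h * L n.+2 n.+1 ^+ j)
| tower_span_D x y : tower_span x -> tower_span y -> tower_span (x + y).

Section TowerStep.
Variable n : nat.
Local Notation span := (@tower_span n).
Local Notation t := (T n.+2 n.+1).
Local Notation i_ := (@ak_incl k e q u n.+1).

Let span0 : span 0.
Proof. by have := tower_span_T (0 : H n.+1) 0; rewrite rmorph0 mulr0. Qed.

Lemma tower_span_mull h x : span x -> span (i_ h * x).
Proof.
elim=> [g g'|g j je|a b _ Sa _ Sb].
- by rewrite !mulrA -rmorphM; apply: tower_span_T.
- by rewrite !mulrA -rmorphM; apply: tower_span_L.
- by rewrite mulrDr; apply: tower_span_D.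
Qed.

Lemma tower_span_scale c x : span x -> span (c *: x).
Proof.
by move=> Sx; have := tower_span_mull c%:A Sx; rewrite ak_incl_alg mulr_algl.
Qed.

(** The cyclotomic relation of [L] reduces the exponents from [e] on. *)
Lemma tower_span_powL h j : span (i_ h * L n.+2 n.+1 ^+ j).
Proof.
have [c ->] := alg_expr_reduce (akL_cyclotomic n.+1) j.
rewrite mulr_sumr; elim/big_rec: _ => [|i x _ Sx]; first exact: span0.
apply: tower_span_D => //; rewrite -scalerAr scalerAl -linearZ.
exact: tower_span_L.
Qed.

Lemma tower_span_incl h : span (i_ h).
Proof. by have := tower_span_powL h 0; rewrite mulr1. Qed.

Lemma tower_span_Tincl h : span (t * i_ h).
Proof. by have := tower_span_T 1 h; rewrite rmorph1 mul1r. Qed.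

End TowerStep.

(* The affine braid relation enters only here: [t x^(j+1) t^-1 x] is, up to
   [t x^(j+2)], the product of [t x^j t^-1 x] and [t x t], where [t = T_1] and
   [x = T_0]. *)
Lemma tower_span_base j : tower_span (L 2 1 ^+ j * T 2 0).
Proof.
have xE : T 2 0 = ak_incl (T 1 0) by rewrite ak_incl_T.
pose x : H 1 := T 1 0; pose t := T 2 1.
have tU : t \is a GRing.unit by exact: TU.
have t2 : t * t = (q - 1) *: t + q%:A by apply: akT_sqr.
have tV : t^-1 = q^-1 *: (t - (q - 1)%:A) by apply: akT_inv.
have braid : t * ak_incl x * t * ak_incl x = ak_incl x * t * ak_incl x * t.
  by rewrite -xE -akT_braid4.
(* H_1 consists of polynomials in [x], and [t x t] commutes with [x] by the affine braid
   relation. *)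
have comm h : t * ak_incl x * t * ak_incl h = ak_incl h * (t * ak_incl x * t).
  have [c ->] := ak1_span h; rewrite rmorph_sum mulr_sumr mulr_suml.
  apply: eq_bigr => i _; rewrite /= linearZ rmorphXn -scalerAr -scalerAl.
  by congr (_ *: _); apply/esym/commr_sym/commrX;
    rewrite /GRing.comm braid !mulrA.
have LtE i : L 2 1 ^+ i * t = t * ak_incl (x ^+ i) by exact: akL_T.
have txt i : t * ak_incl (x ^+ i) * t =
    (q - 1) *: (t * ak_incl (x ^+ i)) + q *: L 2 1 ^+ i.
  by rewrite -LtE -mulrA t2 mulrDr -scalerAr mulr_algr LtE.
have txtS h i : tower_span (ak_incl h * (t * ak_incl (x ^+ i) * t)).
  apply: tower_span_mull; rewrite txt; apply: tower_span_D.
    by apply: tower_span_scale; apply: tower_span_Tincl.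
  apply: tower_span_scale.
  by have := tower_span_powL (1 : H 1) i; rewrite rmorph1 mul1r.
(* Right multiplication by [t x t] preserves the span. In [h t h' (t x t)] it slides past [h'], and
   the square of [t] is then expanded; in [h L^i (t x t)] the product [L^i t] is [t x^i]. *)
have mul_txt w : tower_span w -> tower_span (w * (t * ak_incl x * t)).
  elim=> [h h'|h i _|a b _ Sa _ Sb]; last by rewrite mulrDl;
    apply: tower_span_D.
  - rewrite -mulrA -comm -mulrA; apply: tower_span_mull.
    rewrite -/t !mulrA t2 !mulrDl; apply: tower_span_D.
      rewrite -!scalerAl; apply: tower_span_scale.
      by rewrite comm; have := txtS h' 1%N; rewrite expr1.
    rewrite mulr_algl -!scalerAl; apply: tower_span_scale.
    exact: (tower_span_T x h').
  - rewrite -mulrA [_ * (_ * t)]mulrA [_ ^+ _ * (t * _)]mulrA LtE.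
    rewrite -[t * _ * _]mulrA -rmorphM -exprSr; exact: txtS.
elim: j => [|j IHj].
  by rewrite expr0 mul1r xE; apply: tower_span_incl.
have -> : L 2 1 ^+ j.+1 * T 2 0 = q^-1 *: (L 2 1 ^+ j * T 2 0 * (t * ak_incl x
  * t))
   - q^-1 *: ((q - 1) *: (t * ak_incl (x ^+ j.+2))).
  (* By [comm], [t x t] passes to the left of [x], and its first [t] cancels the [t^-1] of [L]. *)
  have -> : L 2 1 ^+ j * T 2 0 * (t * ak_incl x * t) =
      t * ak_incl (x ^+ j.+1) * t * ak_incl x.
    rewrite akL_conj -/t xE.
    rewrite -mulrA -/x -comm -!mulrA mulKr // !mulrA.
    by rewrite -[t * _ * _]mulrA -rmorphM -exprSr.
  rewrite akL_conj -/t tV -scalerAr -scalerBr -scalerAl; congr (_ *: _).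
  rewrite mulrBr mulr_algr mulrBl -scalerAl; congr (_ - _ *: _).
    by rewrite xE.
  by rewrite xE -mulrA -rmorphM -exprSr.
apply: tower_span_D; first by apply: tower_span_scale; apply: mul_txt.
by rewrite -scaleNr; do 2!apply: tower_span_scale; apply: tower_span_Tincl.
Qed.

(** Induction on [n], writing the last L as [t l t^-1] with [l] the previous one. A non-adjacent T_i
    commutes with [t] and, by induction, with [l]; the adjacent one requires unfolding L twice. *)
Lemma akL_comm n i j : (0 < i <= n)%N ->
  L n.+2 n.+1 ^+ j * T n.+2 i = T n.+2 i * L n.+2 n.+1 ^+ j.
Proof.
move=> ni; apply/esym/commrX; rewrite /GRing.comm.
elim: n i ni => [|n IHn] i /andP[i0 ni]; first by case: i i0 ni.
pose t := T n.+3 n.+2; have tU : t \is a GRing.unit by exact: TU.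
rewrite akLS -/t.
case: (ltngtP i n.+1) ni => [in1|//|->] _.
  have ct : T n.+3 i * t = t * T n.+3 i by apply: akT_comm; rewrite ltnS in1 /=.
  have ctV : T n.+3 i * t^-1 = t^-1 * T n.+3 i.
    by apply: (mulrI tU); rewrite mulVKr // mulrA -ct mulrK.
  have iL : T n.+3 i * L n.+3 n.+1 = L n.+3 n.+1 * T n.+3 i.
    have i2 : (i < n.+2)%N by rewrite ltnW.
    by rewrite -[L _ _]ak_incl_L // -(ak_incl_T i2) -!rmorphM IHn // i0.
  move: (L n.+3 n.+1) iL => l iL.
  by rewrite -[in RHS]mulrA -ctV !mulrA ct -(mulrA t (T n.+3 i)) iL !mulrA.
(* Here L is [t s l s^-1 t^-1]. Multiplied by [s] on the left, it starts with [s t s = t s t]; the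
   last [t] crosses [l], and [t s^-1 t^-1 = s^-1 t^-1 s] releases [s] on the right. *)
pose s := T n.+3 n.+1; have sU : s \is a GRing.unit by exact: TU.
have br : s * t * s = t * s * t by exact: akT_braid3.
pose l := L n.+3 n; have lt : t * l = l * t.
  by rewrite /l -ak_incl_L // -[L _ _]ak_incl_L // akT_incl_comm.
have brV : s * t * s^-1 = t^-1 * s * t.
  by apply: (mulrI tU); rewrite !mulrA divrr // mul1r -br mulrK.
have brV' : t * s^-1 * t^-1 = s^-1 * t^-1 * s.
  apply: (mulrI sU); rewrite !mulrA brV divrr // mul1r.
  by apply: (mulrI tU); rewrite !mulrA divrr // mul1r mulrK.
rewrite akLS -/s -/l !mulrA br -!mulrA; congr (_ * (_ * _)).
rewrite !mulrA lt -!mulrA; congr (_ * _).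
by rewrite !mulrA brV'.
Qed.

Lemma akTLT n j : T n.+2 n.+1 * ak_incl (L n.+1 n ^+ j) * T n.+2 n.+1 =
  (q - 1) *: (T n.+2 n.+1 * ak_incl (L n.+1 n ^+ j)) + q *: L n.+2 n.+1 ^+ j.
Proof.
rewrite -akL_T -mulrA (@akT_sqr n.+2 n.+1) ?ltnSn // mulrDr.
by rewrite -scalerAr mulr_algr akL_T.
Qed.

Lemma tower_span_TLT n j :
  tower_span (T n.+2 n.+1 * ak_incl (L n.+1 n ^+ j) * T n.+2 n.+1).
Proof.
rewrite akTLT; apply: tower_span_D; apply: tower_span_scale.
  exact: tower_span_Tincl.
by have := tower_span_powL (1 : H n.+1) j; rewrite rmorph1 mul1r.
Qed.

(** The span contains 1, so stability under right multiplication by the generators is enough. The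
    hypotheses are the two cases not settled by absorbing the generator into [h'] or by moving it
    across a power of [L]. *)
Lemma tower_span_full n :
    (forall h, tower_span (T n.+2 n.+1 * ak_incl h * T n.+2 n.+1)) ->
    (forall j, tower_span (L n.+2 n.+1 ^+ j * T n.+2 0)) ->
  forall x : H n.+2, tower_span x.
Proof.
move=> spanT span0 x; suff gen w : tower_span w -> tower_span (w * x).
  rewrite -[x]mul1r; apply: gen; rewrite -[1](rmorph1 (@ak_incl _ _ q u _)).
  exact: tower_span_incl.
elim/ak_gen_ind: x w => [c|i ni|a b Sa Sb|a b Sa Sb] w Sw.
- by rewrite mulr_algr; apply: tower_span_scale.
- elim: Sw => [h h'|h j _|a b _ Sa _ Sb]; last by rewrite mulrDl;
    apply: tower_span_D.
    have [->|in1] := eqVneq i n.+1.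
      by rewrite -!mulrA; apply: tower_span_mull; rewrite mulrA.
    have ni1 : (i < n.+1)%N by rewrite ltn_neqAle in1 -ltnS.
    by rewrite -mulrA -(ak_incl_T ni1) -rmorphM; apply: tower_span_T.
  rewrite -mulrA; apply: tower_span_mull.
  have [->|in1] := eqVneq i n.+1; first by rewrite akL_T;
    apply: tower_span_Tincl.
  have ni1 : (i <= n)%N by rewrite -ltnS ltn_neqAle in1 -ltnS.
  case: i ni in1 ni1 => [|i] ni in1 ni1; first exact: span0.
  by rewrite akL_comm // -ak_incl_T //; apply: tower_span_powL.
- by rewrite mulrDr; apply: tower_span_D; [apply: Sa | apply: Sb].
- by rewrite mulrA; apply: Sb; apply: Sa.
Qed.

(** Decompose [h] one level down: a factor T_{n+1} between the two T_{n+2} is handled by the braid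
    relation, a power of L_{n+1} by the quadratic one. *)
Lemma tower_span_TT n : (forall x : H n.+2, tower_span x) ->
  forall h, tower_span (T n.+3 n.+2 * ak_incl h * T n.+3 n.+2).
Proof.
move=> full h; elim: {h}(full h) => [h h'|h j _|a b _ Sa _ Sb].
- rewrite !rmorphM /= (ak_incl_T (ltnSn n.+1)).
  have -> : T n.+3 n.+2 *
       (ak_incl (ak_incl h) * T n.+3 n.+1 * ak_incl (ak_incl h')) * T n.+3
         n.+2 =
     ak_incl (ak_incl h) * T n.+3 n.+1 * T n.+3 n.+2 *
       (T n.+3 n.+1 * ak_incl (ak_incl h')).
    rewrite -!mulrA -akT_incl_comm !mulrA akT_incl_comm -!mulrA; congr (_ * _).
    by rewrite !mulrA akT_braid3.
  by rewrite -(ak_incl_T (ltnSn n.+1)) -!rmorphM; apply: tower_span_T.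
- rewrite rmorphM mulrA akT_incl_comm -2!mulrA; apply: tower_span_mull.
  by rewrite mulrA; apply: tower_span_TLT.
- by rewrite rmorphD mulrDr mulrDl; apply: tower_span_D.
Qed.

Theorem tower_spanP n (x : H n.+2) : tower_span x.
Proof.
elim: n x => [|n IHn]; apply: tower_span_full.
- move=> h; have [c ->] := ak1_span h; rewrite rmorph_sum mulr_sumr mulr_suml.
  elim/big_rec: _ => [|i x _ Sx].
    by rewrite -[0](rmorph0 (@ak_incl _ _ q u _)); apply: tower_span_incl.
  apply: tower_span_D => //; rewrite /= linearZ -scalerAr -scalerAl.
  by apply: tower_span_scale; apply: tower_span_TLT.
- exact: tower_span_base.
- exact: tower_span_TT.
(* From here on [t] commutes with T_0: moving T_0 inward and expanding [t^-1] by the quadratic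
   relation leaves elements [t h t] and [t h]. *)
move=> j; rewrite akL_conj akT_divr ?ltnSn //.
set t := T n.+3 n.+2; set l := L n.+2 n.+1 ^+ j.
have t0 : t * T n.+3 0 = T n.+3 0 * t by apply/esym/akT_comm => /=;
  rewrite ltnSn.
have T0E : T n.+3 0 = ak_incl (T n.+2 0) by rewrite ak_incl_T.
have -> : (q^-1 *: (t * ak_incl l * t - (q - 1) *: (t * ak_incl l))) * T n.+3
  0 =
    q^-1 *: (t * ak_incl (l * T n.+2 0) * t - (q - 1) *: (t * ak_incl (l * T
      n.+2 0))).
  rewrite rmorphM /= -T0E -scalerAl mulrBl -scalerAl; congr (_ *: (_ - _ *: _)).
    by rewrite -[LHS]mulrA t0 !mulrA.
  by rewrite mulrA.
apply: tower_span_scale; rewrite -scaleNr; apply: tower_span_D.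
  exact: tower_span_TT.
by apply: tower_span_scale; apply: tower_span_Tincl.
Qed.

End Tower.

(** * Standard tableaux of hook shape *)

Section Counting.
Local Open Scope nat_scope.
Implicit Types (f : nat -> bool) (m c : nat).

Definition cnt f m : nat := \sum_(i < m) f i.

Lemma cnt0 f : cnt f 0 = 0. Proof. exact: big_ord0. Qed.

Lemma cntS f m : cnt f m.+1 = cnt f m + f m.
Proof. exact: big_ord_recr. Qed.

Lemma cntC f m : cnt f m + cnt (predC f) m = m.
Proof. by elim: m => [|m IHm]; rewrite ?cnt0 // !cntS /=; case: (f m); lia. Qed.

Lemma cnt_lt f l m : l < m -> f l -> cnt f l < cnt f m.
Proof.
move=> lm fl; elim: m lm => // m IHm;
  rewrite ltnS leq_eqVlt cntS => /predU1P[<-|/IHm].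
  by rewrite fl addn1.
by move/leq_trans; apply; exact: leq_addr.
Qed.

Lemma cnt_le f l m : l <= m -> cnt f l <= cnt f m.
Proof.
move=> lm; elim: m lm => [|m IHm]; first by rewrite leqn0 => /eqP->.
rewrite leq_eqVlt cntS => /predU1P[->|/IHm]; first by rewrite cntS.
by move/leq_trans; apply; exact: leq_addr.
Qed.

Lemma cnt_attained f m c : c < cnt f m -> exists i, [/\ i < m, f i & cnt f i =
  c].
Proof.
elim: m => [|m IHm]; first by rewrite cnt0.
rewrite cntS; have [/IHm [i [im fi <-]] _|mc cm] := ltnP c (cnt f m).
  by exists i; split=> //; exact: ltnW.
by exists m; move: cm; case: (f m); split; lia.
Qed.

Lemma eq_cnt f g m : (forall i, i < m -> f i = g i) -> cnt f m = cnt g m.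
Proof. by move=> fg; apply: eq_bigr => i _; rewrite fg. Qed.

(** Strong induction on [i]. If [pos i] were below the rank of [i], the smaller entry of that rank
    would already occupy it; if above, the position equal to the rank would be held by a smaller
    entry, whose rank is too small. *)
Lemma increasing_filling n f (pos : 'I_n -> nat) :
    (forall i l : 'I_n, f i -> f l -> pos l < pos i -> l < i) ->
    (forall i l : 'I_n, f i -> f l -> pos l = pos i -> l = i) ->
    (forall (i : 'I_n) c, f i -> c < pos i -> exists2 l : 'I_n, f l & pos l =
      c) ->
  forall i : 'I_n, f i -> pos i = cnt f i.
Proof.
move=> mono inj onto i; have [m] := ubnP (i : nat);
  elim: m i => // m IHm i im fi.
case: (ltngtP (pos i) (cnt f i)) => // [/cnt_attained [l [li fl lE]]|ci].
  have ln := ltn_trans li (ltn_ord i).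
  have pl := IHm (Ordinal ln) (leq_trans li im) fl.
  have := inj _ (Ordinal ln) fi fl (etrans pl lE).
  by move=> E; move: li; rewrite -E ltnn.
have [l fl lE] := onto _ _ fi ci; have li : l < i by apply: mono; rewrite ?lE.
by have := cnt_lt li fl; rewrite -lE IHm ?ltnn // (leq_trans li im).
Qed.

End Counting.

(** * Hook tableaux and their sets of arm entries *)

Section HookTableaux.
Local Open Scope nat_scope.
Variables (n a : nat) (an : a <= n).

Lemma nth_hook r : nth 0 (hook n.+1 a) r = if r == 0 then a.+1 else (r <= n -
  a) : nat.
Proof. by rewrite /hook subSS; case: r => //= r; rewrite nth_nseq;
  case: ltnP. Qed.

(** The box that entry [i] must occupy when [f] singles out the arm entries. The corner counts in
    the arm, so the leg starts at row 1. *)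
Definition hook_box (f : nat -> bool) i : nat * nat :=
  if f i then (0, cnt f i) else ((cnt (predC f) i).+1, 0).

Definition arm (t : tableau n.+1) (i : nat) : bool := (t (inord i)).1 == 0 :>
  nat.

Lemma armE t (i : 'I_n.+1) : arm t i = ((t i).1 == 0 :> nat).
Proof. by rewrite /arm inord_val. Qed.

Section Standard.
Variable (t : tableau n.+1).
Hypothesis t_std : is_standard (hook n.+1 a) t.

Let t_inj : injective t. Proof. by case/and4P: t_std => /injectiveP. Qed.

Let t_shape (b : 'I_n.+1 * 'I_n.+1) :
  (b \in codom t) = (b.2 < if b.1 == 0 :> nat then a.+1 else (b.1 <= n - a) :
    nat).
Proof. by case/and4P: t_std => _ /forallP /(_ b) /eqP -> _ _;
  rewrite nth_hook. Qed.

Let t_row i j : (t i).1 = (t j).1 -> (t i).2 < (t j).2 -> i < j.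
Proof.
case/and4P: t_std => _ _ /forallP /(_ i) /forallP /(_ j) /implyP h _ e l.
by apply: h; rewrite e eqxx.
Qed.

Let t_col i j : (t i).2 = (t j).2 -> (t i).1 < (t j).1 -> i < j.
Proof.
case/and4P: t_std => _ _ _ /forallP /(_ i) /forallP /(_ j) /implyP h e l.
by apply: h; rewrite e eqxx.
Qed.

Let leg_col i : (t i).1 != 0 :> nat -> (t i).2 = 0 :> nat.
Proof.
move=> ti; have := t_shape (t i); rewrite codom_f (negPf ti) => /esym.
by case: (_ <= n - a); case: (nat_of_ord (t i).2).
Qed.

(** Otherwise entry 0 would lie in the first column, strictly below the entry of the corner, which
    would be smaller. *)
Lemma arm0 : arm t 0.
Proof.
rewrite /arm -[0]/(nat_of_ord (@ord0 n)) inord_val; apply/negP => /negP t0.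
have : (ord0, ord0) \in codom t by rewrite t_shape.
case/codomP => l tl; suff : l < (ord0 : 'I_n.+1) by [].
apply: t_col; rewrite -tl /=; last by rewrite lt0n.
by apply/val_inj; rewrite /= leg_col.
Qed.

(** A hook tableau is determined by its arm: [increasing_filling] applies to the columns along the
    arm and to the rows, shifted by one, along the leg. *)
Lemma standard_box i : (val (t i).1, val (t i).2) = hook_box (arm t) i.
Proof.
rewrite /hook_box; case: ifP => fi.
  have t1 (l : 'I_n.+1) : arm t l -> (t l).1 = ord0 by rewrite armE => /eqP E;
    apply/val_inj.
  congr pair; first by rewrite t1.
  apply: (@increasing_filling n.+1 (arm t) (fun i => val (t i).2)) => // {fi}i.
  - by move=> l fi fl; apply: t_row; rewrite !t1.
  - move=> l fi fl /val_inj E; apply: t_inj.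
    by rewrite (surjective_pairing (t l)) (surjective_pairing (t i)) E !t1.
  - move=> c fi ci; have cn : c < n.+1 by exact: ltn_trans ci (ltn_ord _).
    have : (ord0, Ordinal cn) \in codom t.
      rewrite t_shape /=; apply: ltn_trans ci _.
      by have := t_shape (t i); rewrite codom_f t1.
    by case/codomP => l tl; exists l; rewrite ?armE -tl.
have t2 (l : 'I_n.+1) : ~~ arm t l -> (t l).2 = ord0.
  by rewrite armE => /leg_col => E; apply/val_inj.
have t1 (l : 'I_n.+1) : ~~ arm t l -> 0 < (t l).1 by rewrite armE lt0n.
have {}fi : ~~ arm t i by rewrite fi.
congr pair; last by rewrite t2.
rewrite -(@increasing_filling n.+1 (predC (arm t)) (fun i => (val (t
  i).1).-1)) //.
  by rewrite prednK // t1.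
all: move=> {fi}i.
- move=> l fi fl li; apply: t_col; rewrite ?t2 //.
  by have := t1 i fi; have := t1 l fl; move: li => /=; lia.
- move=> l fi fl E; apply: t_inj.
  rewrite (surjective_pairing (t l)) (surjective_pairing (t i)) !t2 //;
    congr pair.
  by apply/val_inj; have := t1 i fi; have := t1 l fl; move: E => /=; lia.
- move=> c fi ci; have cn : c.+1 < n.+1.
    by apply: leq_ltn_trans (ltn_ord (t i).1); have := t1 i fi; move: ci => /=;
      lia.
  have ri : (t i).1 <= n - a.
    have := t_shape (t i); rewrite codom_f t2 // eqn0Ngt t1 //= => /esym.
    by case: (_ <= n - a).
  have : (Ordinal cn, ord0) \in codom t.
    by rewrite t_shape /= lt0b; have := t1 i fi; move: ci ri => /=; lia.
  by case/codomP => l tl; exists l; rewrite /= ?armE -tl.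
Qed.

(** The last arm entry lies in a column of index at most [a], and the box in column [a] is occupied
    by an arm entry of rank [a]. *)
Lemma cnt_arm : cnt (arm t) n.+1 = a.+1.
Proof.
apply/eqP; rewrite eqn_leq; apply/andP; split.
  have c0 : 0 < cnt (arm t) n.+1 by rewrite (leq_trans _ (cnt_lt (ltn0Sn n)
    arm0)).
  have [|i [ni fi iE]] := @cnt_attained (arm t) n.+1 (cnt (arm t) n.+1).-1.
    by rewrite prednK.
  have := standard_box (Ordinal ni); rewrite /hook_box /= fi iE => -[t1 t2].
  by have := t_shape (t (Ordinal ni)); rewrite codom_f t1 t2 prednK.
have an1 : a < n.+1 by [].
have : (ord0, Ordinal an1) \in codom t by rewrite t_shape.
case/codomP => l tl; have := standard_box l; rewrite -tl /hook_box.
case: ifP => // fl [->]; exact: cnt_lt.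
Qed.

End Standard.

Definition hook_tableau (f : nat -> bool) : tableau n.+1 :=
  [ffun i : 'I_n.+1 => (inord (hook_box f i).1, inord (hook_box f i).2)].

(** Since entry 0 is not in the leg, the row indices do not exceed [n], and [inord] alters no
    coordinate. *)
Lemma hook_tableauE (f : nat -> bool) (i : 'I_n.+1) : f 0 ->
  (val (hook_tableau f i).1, val (hook_tableau f i).2) = hook_box f i.
Proof.
move=> f0; rewrite ffunE /= !inordK.
- by case: hook_box.
- rewrite /hook_box; have := cntC f i; have := ltn_ord i.
  by case: ifP => /=; lia.
rewrite /hook_box; case: ifP => // fi /=; rewrite ltnS.
case: i fi => [[|i] ni] //= fi; first by rewrite f0 in fi.
have := cntC f i.+1; have := cnt_lt (ltn0Sn i) f0; lia.
Qed.

Lemma hook_tableau_standard (f : nat -> bool) : f 0 -> cnt f n.+1 = a.+1 ->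
  is_standard (hook n.+1 a) (hook_tableau f).
Proof.
move=> f0 fa; set t := hook_tableau f.
have tE i : (val (t i).1, val (t i).2) = hook_box f i by exact: hook_tableauE.
have t1 i : val (t i).1 = (hook_box f i).1 by rewrite -tE.
have t2 i : val (t i).2 = (hook_box f i).2 by rewrite -tE.
have t_eq i l : (hook_box f i).1 = (hook_box f l).1 ->
    (hook_box f i).2 < (hook_box f l).2 -> i < l.
  rewrite /hook_box; case: ifP => fi; case: ifP => fl //= _;
    rewrite ltnNge => h.
  rewrite ltnNge; apply: contra h; exact: cnt_le.
have t_eq' i l : (hook_box f i).2 = (hook_box f l).2 ->
    (hook_box f i).1 < (hook_box f l).1 -> i < l.
  rewrite /hook_box; case: ifP => fi; case: ifP => fl //=; last first.
    by move=> _; rewrite ltnS ltnNge => h; rewrite ltnNge; apply: contra h;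
      apply: cnt_le.
  (* An arm entry in column 0 has rank 0, so it is entry 0, which precedes every leg entry. *)
  move=> E _; case: i fi E => [|i] fi E; first by case: l fl; rewrite ?f0.
  by have := cnt_lt (ltn0Sn i) f0; rewrite E.
have box_inj i l : hook_box f i = hook_box f l -> i = l.
  rewrite /hook_box; case: ifP => fi; case: ifP => fl // [] E.
    by apply/eqP; case: (ltngtP i l) => // /cnt_lt h; move: (h f);
      rewrite ?fi ?fl E ltnn => /(_ isT).
  apply/eqP; case: (ltngtP i l) => // /(@cnt_lt (predC f)) h; move: h;
  by rewrite /= ?fi ?fl E ltnn => /(_ isT).
apply/and4P; split.
- apply/injectiveP => i l E; apply/val_inj/box_inj; by rewrite -!tE E.
- apply/forallP => -[r c]; apply/eqP; rewrite nth_hook /=; apply/codomP/idP.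
    move=> [i rc]; have := tE i; rewrite -rc /= /hook_box.
    case: ifP => fi [-> ->] /=; first by rewrite -fa cnt_lt.
    rewrite lt0b; have := cntC f n.+1; rewrite fa.
    have : cnt (predC f) i < cnt (predC f) n.+1 by rewrite cnt_lt //= fi.
    lia.
  case: ifP => [/eqP r0|r0].
    rewrite -fa => /cnt_attained [i [ni fi ic]]; exists (Ordinal ni).
    have := tE (Ordinal ni); rewrite /hook_box /= fi ic => -[t1i t2i].
    rewrite (surjective_pairing (t _)); congr pair; apply/val_inj => //=.
    by rewrite t1i.
  case rn: (_ <= n - a) => // c1.
  have {c1} c0 : c = 0 :> nat by move: c1; case: (nat_of_ord c).
  have : r.-1 < cnt (predC f) n.+1.
    have := cntC f n.+1; rewrite fa; case: (r : nat) r0 rn => //= r' _; lia.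
  move/cnt_attained => [i [ni fi ic]]; exists (Ordinal ni).
  have := tE (Ordinal ni); rewrite /hook_box /= (negPf fi) ic => -[t1i t2i].
  rewrite (surjective_pairing (t _)); congr pair; apply/val_inj => //=.
    by rewrite t1i prednK // lt0n r0.
  by rewrite t2i.
- apply/forallP => i; apply/forallP => l; apply/implyP => /andP[/eqP e].
  by rewrite t2 t2; apply: t_eq; rewrite -t1 e t1.
- apply/forallP => i; apply/forallP => l; apply/implyP => /andP[/eqP e].
  by rewrite t1 t1; apply: t_eq'; rewrite -t2 e t2.
Qed.

End HookTableaux.

(** * The sum of the hook modules *)

Section Bits.
Local Open Scope nat_scope.

(** Records which of the entries 1, ..., n of a hook tableau lie in the arm. With nested pairs,
    forgetting the last entry is the first projection. *)
Fixpoint bits (n : nat) : finType :=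
  if n is m.+1 then (bits m * bool)%type else unit.

(* Bit 0, the corner of a hook, always counts as an arm box. *)
Fixpoint bit n : bits n -> nat -> bool :=
  match n with
  | 0 => fun _ i => i == 0
  | m.+1 => fun S i => if i == m.+1 then S.2 else bit S.1 i
  end.

Fixpoint mkbits n (f : nat -> bool) : bits n :=
  match n with
  | 0 => tt
  | m.+1 => (mkbits m f, f m.+1)
  end.

(** This is the parameter [a] of the hook: the arm length without the corner. *)
Fixpoint ones n : bits n -> nat :=
  match n with
  | 0 => fun=> 0
  | m.+1 => fun S => S.2 + ones S.1
  end.

Lemma bit0 n (S : bits n) : bit S 0.
Proof. by elim: n S => //= n IHn S; exact: IHn. Qed.

Lemma bit_mkbits n f i : bit (mkbits n f) i = (i == 0) || (i <= n) && f i.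
Proof.
elim: n => [|n IHn] /=; first by case: i.
by case: eqP => [->|/eqP ni];
  rewrite ?leqnn // IHn [i <= n.+1]leq_eqVlt (negPf ni).
Qed.

Lemma bit_inj n (S S' : bits n) :
  (forall i, i <= n -> bit S i = bit S' i) -> S = S'.
Proof.
elim: n S S' => [[] []|n IHn] //= [S b] [S' b'] E; congr pair.
  apply: IHn => i ni; have := E i (leqW ni); rewrite /= ltn_eqF //.
by have := E n.+1 (leqnn _); rewrite /= eqxx.
Qed.

Lemma mkbitsK n (S : bits n) : mkbits n (bit S) = S.
Proof. by apply: bit_inj => i ni; rewrite bit_mkbits ni /=; case: eqP => // ->;
  rewrite bit0. Qed.

Lemma eq_mkbits n f g : (forall i, i <= n -> f i = g i) -> mkbits n f = mkbits
  n g.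
Proof. by move=> fg; apply: bit_inj => i ni; rewrite !bit_mkbits ni fg. Qed.

Lemma ones_cnt n (S : bits n) : (ones S).+1 = cnt (bit S) n.+1.
Proof.
elim: n S => [|n IHn] S; first by rewrite cntS cnt0.
rewrite cntS /= eqxx -addnS IHn addnC; congr (_ + _).
by apply: eq_cnt => i ni /=; rewrite ltn_eqF.
Qed.

Lemma ones_le n (S : bits n) : ones S <= n.
Proof.
by elim: n S => [|n IHn] //= S; rewrite -add1n leq_add ?leq_b1.
Qed.

Lemma sum_bitsS (V : nmodType) n (F : bits n.+1 -> V) :
  (\sum_S F S = \sum_S \sum_b F (S, b))%R.
Proof. by rewrite pair_bigA; apply: eq_bigr => -[]. Qed.

Definition swapn j i := if i == j.-1 then j else if i == j then j.-1 else i.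

(** For [j = 1] the bit sent to position 0 is lost, hence the bound [1 < j] in [ones_swap]. *)
Definition swap j n (S : bits n) : bits n := mkbits n (fun i => bit S (swapn j
  i)).

(** Only for [m = j] does the initial segment separate [j.-1] from [j]. *)
Lemma cnt_swapn f j m : 0 < j -> m != j -> cnt (fun i => f (swapn j i)) m =
  cnt f m.
Proof.
case: j => // j _; rewrite /swapn /=; elim: m {-2}m (leqnn m) => [|m IHm] l.
  by rewrite leqn0 => /eqP->; rewrite !cnt0.
case: l => [|l] lm lj; first by rewrite !cnt0.
rewrite !cntS; have [lj1|lj1] := eqVneq l j.+1.
  rewrite lj1 !cntS eqxx gtn_eqF // IHm; [lia|by move: lm; rewrite lj1;
    lia|lia].
by rewrite ifN_eq // ?(IHm l) //; case: eqP lj => [->|]; lia.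
Qed.

Lemma ones_swap j n (S : bits n) : 1 < j <= n -> ones (swap j S) = ones S.
Proof.
move=> jn; apply: succn_inj; rewrite !ones_cnt.
rewrite -[RHS](@cnt_swapn _ j); [|lia|lia]; apply: eq_cnt => i ni.
rewrite bit_mkbits -ltnS ni /=; case: eqP => //= ->.
by rewrite /swapn; do ![case: eqP]; rewrite ?bit0 //; lia.
Qed.

End Bits.

(** * Matrices of the generators on all the hook modules together *)

Section Kernels.
Variables (k : fieldType) (q v : k).

Definition signed_dist (j : nat) (b : bool) : int := if b then - j%:Z else j%:Z.

(* On hook tableaux, the content difference of the boxes of [j - 1] and [j],
   one in the arm and the other in the leg, is [j] up to sign.  At [j = 1] the
   coefficient of the swap vanishes, so that the corner stays in place. *)
Definition gen_kernel n (j : nat) (S S' : bits n) : k :=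
  if j == 0%N then v * (S == S')%:R
  else if bit S' j.-1 == bit S' j then (if bit S' j then q else -1) * (S ==
    S')%:R
  else let d := signed_dist j (bit S' j) in
    (1 - q ^ d)^-1 *
      ((q - 1) * (S == S')%:R + q * (1 - q ^ (d - 1)) * (S == swap j S')%:R).

(** Defined on terms, not on the algebra: compatibility with the relations is deduced later from the
    given hook representations. *)
Fixpoint kernel n (x : aterm k 'I_n.+1) : bits n -> bits n -> k :=
  match x with
  | AVar i => gen_kernel i
  | AConst c => fun S S' => c * (S == S')%:R
  | AAdd x y => fun S S' => kernel x S S' + kernel y S S'
  | AMul x y => fun S S' => \sum_U kernel x S U * kernel y U S'
  end.

(** The matrices are block diagonal, with one block for each hook, because swaps with [1 < j]
    preserve [ones]. *)
Lemma kernel_ones n (x : aterm k 'I_n.+1) S S' :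
  ones S != ones S' -> kernel x S S' = 0.
Proof.
have neq (A B : bits n) : ones A != ones B -> (A == B) = false.
  by apply: contraNF => /eqP->.
elim: x S S' => [j|c|x IHx y IHy|x IHx y IHy] S S' SS' /=.
- rewrite /gen_kernel neq // !mulr0; case: ifP => // /negbT j0;
    case: ifP => // jj.
  (* For [j = 1] the bits differ only if entry 1 is in the leg; then [d = 1] and the coefficient
     [1 - q ^ (d - 1)] is zero. *)
  rewrite add0r; have [j1|j1] := eqVneq (j : nat) 1%N.
    move: jj; rewrite j1 /= bit0 eq_sym eqb_id => /negbT jj.
    by rewrite (negPf jj) /signed_dist (subrr 1%:Z) expr0z subrr mulr0 mul0r
      mulr0.
  rewrite neq ?mulr0 // ones_swap //; have := ltn_ord j; lia.
- by rewrite neq // mulr0.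
- by rewrite IHx // IHy // addr0.
rewrite big1 // => U _; have [SU|SU] := eqVneq (ones S) (ones U).
  by rewrite IHy ?mulr0 // -SU.
by rewrite IHx ?mul0r.
Qed.

Section Link.
Hypothesis q_neq1 : q != 1.
Variables (n a : nat) (an : (a <= n)%N).
Local Notation std t := (is_standard (hook n.+1 a) t).

Definition tab_bits (t : tableau n.+1) : bits n := mkbits n (arm t).

Lemma bit_tab t i : std t -> (i <= n)%N -> bit (tab_bits t) i = arm t i.
Proof.
by move=> st ni; rewrite bit_mkbits ni /=; case: eqP => // ->;
  rewrite (arm0 st).
Qed.

Lemma ones_tab t : std t -> ones (tab_bits t) = a.
Proof.
move=> st; apply: succn_inj; rewrite ones_cnt -(cnt_arm an st).
by apply: eq_cnt => i ni; rewrite bit_tab.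
Qed.

Lemma eq_hook_box f g i : (forall l, (l <= i)%N -> f l = g l) ->
  hook_box f i = hook_box g i.
Proof.
move=> fg; rewrite /hook_box fg // (eq_cnt (g := g)) ?(@eq_cnt (predC f)
  (predC g)) //.
- by move=> l li; rewrite /= fg // ltnW.
- by move=> l li; rewrite fg // ltnW.
Qed.

Lemma tab_bits_inj s t : std s -> std t -> tab_bits s = tab_bits t -> s = t.
Proof.
move=> ss st E; apply/ffunP => i.
have : (val (s i).1, val (s i).2) = (val (t i).1, val (t i).2).
  rewrite (standard_box an ss) (standard_box an st); apply: eq_hook_box => l li.
  have ln : (l <= n)%N by rewrite (leq_trans li) // -ltnS.
  by rewrite -(bit_tab ss) // -(bit_tab st) // E.
case=> /val_inj E1 /val_inj E2.
by rewrite (surjective_pairing (s i)) E1 E2 -surjective_pairing.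
Qed.

Lemma tab_bits_onto S : ones S = a -> exists2 t, std t & tab_bits t = S.
Proof.
move=> Sa; have st : std (hook_tableau n (bit S)).
  by apply: hook_tableau_standard; rewrite ?bit0 // -ones_cnt Sa.
exists (hook_tableau n (bit S)) => //; rewrite -[RHS]mkbitsK;
  apply: eq_mkbits => i ni.
have -> : i = Ordinal (ni : (i < n.+1)%N) by [].
rewrite armE; have := hook_tableauE an (Ordinal (ni : (i < n.+1)%N)) (bit0 S).
by rewrite /hook_box /=; case: (bit S i) => -[-> _].
Qed.

Lemma eq_tab_bits s t : std s -> std t -> (tab_bits s == tab_bits t) = (s == t).
Proof.
by move=> ss st; apply/eqP/eqP => [/(tab_bits_inj ss st)|->].
Qed.

(** The entries [j.-1] and [j] lie in different parts, so neither counts in the rank of the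
    other. *)
Lemma hook_box_swapn (f : nat -> bool) j m : (0 < j)%N -> f j.-1 != f j ->
  hook_box (fun i => f (swapn j i)) m = hook_box f (swapn j m).
Proof.
case: j => // j _ /= fj; have cs g := cnt_swapn g (ltn0Sn j).
have sj : swapn j.+1 j = j.+1 by rewrite /swapn eqxx.
have sSj : swapn j.+1 j.+1 = j by rewrite /swapn /= eqxx gtn_eqF.
rewrite /hook_box; have [->|mj] := eqVneq m j.
  have jj : j != j.+1 by rewrite ltn_eqF.
  rewrite sj (cs _ f) // (cs _ (predC f)) // !cntS /=.
  by move: fj; case: (f j); case: (f j.+1); rewrite ?addn0.
have [->|mSj] := eqVneq m j.+1.
  have jj : j != j.+1 by rewrite ltn_eqF.
  rewrite sSj !cntS (cs _ f) // (cs _ (predC f)) // /= sj.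
  by move: fj; case: (f j); case: (f j.+1); rewrite ?addn0.
by rewrite (cs _ f) // (cs _ (predC f)) // /swapn /= (negPf mj) (negPf mSj).
Qed.

Lemma tperm_swapn (i j m : 'I_n.+1) : j = i.+1 :> nat ->
  tperm i j m = swapn j m :> nat.
Proof.
move=> ji; rewrite /swapn ji /= -ji; case: tpermP => [->|->|/eqP mi /eqP mj].
- by rewrite eqxx.
- by rewrite eqxx gtn_eqF // ji.
- by rewrite -!val_eqE /= in mi mj; rewrite (negPf mi) (negPf mj).
Qed.

Lemma eq_tab_exchange (i j : 'I_n.+1) s t : j = i.+1 :> nat -> (0 < i)%N ->
  std s -> std t -> arm t i != arm t j ->
  (tab_bits s == swap j (tab_bits t)) = (s == exchange i j t).
Proof.
move=> ji i0 ss st ij; have jn := ltn_ord j.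
have exE (m : 'I_n.+1) : (val (exchange i j t m).1, val (exchange i j t m).2) =
    hook_box (fun m => arm t (swapn j m)) m.
  have j0 : (0 < j)%N by rewrite ji.
  have ij' : arm t j.-1 != arm t j by rewrite {1}ji.
  by rewrite (hook_box_swapn _ j0 ij') ffunE (standard_box an st) tperm_swapn.
have swE m : (m <= n)%N -> bit (swap j (tab_bits t)) m = arm t (swapn j m).
  move=> mn; rewrite bit_mkbits mn /=.
  have sn : (swapn j m <= n)%N by rewrite /swapn; case: ifP => _;
    last case: ifP; lia.
  rewrite bit_tab //; case: eqP => // ->.
  by rewrite /swapn ji /= !ltn_eqF // (arm0 st).
apply/eqP/eqP => [E|E].
  apply/ffunP => m; have mn : (m <= n)%N by rewrite -ltnS.
  have : (val (s m).1, val (s m).2) =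
      (val (exchange i j t m).1, val (exchange i j t m).2).
    rewrite exE (standard_box an ss); apply: eq_hook_box => l li.
    by rewrite -swE -?E ?bit_tab // (leq_trans li).
  case=> /val_inj E1 /val_inj E2.
  by rewrite (surjective_pairing (s m)) E1 E2 -surjective_pairing.
apply: bit_inj => m mn; rewrite swE // bit_tab // E.
have -> : m = Ordinal (mn : (m < n.+1)%N) by [].
rewrite armE; have := exE (Ordinal (mn : (m < n.+1)%N)).
by rewrite /hook_box /=; case: (arm t _) => -[-> _].
Qed.

(** Two consecutive entries in the same part are adjacent. In different parts, the content
    difference adds up the arm and leg entries below [i], plus one, which makes [j] up to sign. *)
Lemma tab_kernel (i j : 'I_n.+1) s t : j = i.+1 :> nat -> std s -> std t ->
  tab_coef q i j s t = gen_kernel j (tab_bits s) (tab_bits t).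
Proof.
move=> ji ss st; have jn : (j <= n)%N by rewrite -ltnS.
have bj : bit (tab_bits t) j = arm t j by rewrite bit_tab.
have bi : bit (tab_bits t) j.-1 = arm t i by rewrite ji bit_tab //; lia.
have j0 : (j == 0%N :> nat) = false by rewrite ji.
have := standard_box an st j; have := standard_box an st i.
rewrite /gen_kernel j0 bj bi eq_tab_bits // /tab_coef -!val_eqE /= /content.
rewrite {1 2}/hook_box ji !cntS /= -ji.
case fi: (arm t i); case fj: (arm t j) => /= -[-> ->] [-> ->] /=.
- by rewrite addn1 !eqxx.
- have cC := cntC (arm t) i.
  (* If [i = 0], entry 1 is directly below the corner: the tableau rule gives -1, and the kernel
     gives [(q - 1) / (1 - q)] with no swap term. *)
  have [i0|i0] := eqVneq (i : nat) 0%N.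
    rewrite {1 2 3 4}i0 !cnt0 /= ji i0 (subrr 1%:Z) expr0z subrr mulr0 mul0r
      addr0.
    by rewrite expr1z -[q - 1]opprB mulNr mulrN mulKf // subr_eq0 eq_sym.
  have := cnt_lt (_ : (0 < i)%N) (arm0 st); rewrite lt0n => /(_ i0).
  move=> ci; rewrite gtn_eqF ?(leq_ltn_trans _ ci) //=.
  have -> : ((cnt (arm t) i)%:Z - 0%Z - (0%Z - (cnt (predC (arm t)) i +
    0).+1%:Z) = j)%R.
    by rewrite ji; lia.
  by rewrite (eq_tab_exchange ji _ ss st) ?fi ?fj // lt0n.
- have cC := cntC (arm t) i; rewrite /= andbF.
  have i0 : (0 < i)%N by rewrite lt0n; apply: contraFN fi => /eqP->;
    exact: arm0 st.
  have -> : (0%Z - (cnt (predC (arm t)) i).+1%:Z - ((cnt (arm t) i + 0)%N%:Z -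
    0%Z) = - j%:Z)%R.
    by rewrite ji; lia.
  by rewrite (eq_tab_exchange ji _ ss st) ?fi ?fj.
- by rewrite andbF addn1 eqxx mulN1r.
Qed.

End Link.
End Kernels.

(** * The alternating sum of the hook characters *)

Section HookTrace.
Variables (k : fieldType) (e : nat) (q : k) (u : 'I_e -> k).
Hypotheses (e_gt0 : (0 < e)%N) (q_neq0 : q != 0) (u_neq0 : forall p, u p != 0).
Hypothesis q_nroot : forall i, q ^+ i.+1 != 1.

Local Notation H := (akAlg q u).
Local Notation T := (akT q u).
Local Notation L := (akL q u).

Variable (p : 'I_e).
Local Notation kernel := (kernel q (u p)).

Definition supertrace n (A : bits n -> bits n -> k) : k :=
  \sum_S (-1) ^+ ones S * A S S.

(** Says that the kernels define an action of the algebra on the sum of the hook modules of size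
    [n.+1]. *)
Definition kernel_sound n := forall x y : aterm k 'I_n.+1,
  acong (@ak_rel k e q u n.+1) x y -> kernel x =2 kernel y.

Section Hooks.
Variable (n : nat).

Section OneHook.
Variables (a : nat) (an : (a <= n)%N).

Local Notation tab r := (val (enum_val r : std_tableau n.+1 (hook n.+1 a))).

Lemma sum_tab_bits (F : bits n -> k) :
  \sum_(U | ones U == a) F U =
  \sum_(r < #|{: std_tableau n.+1 (hook n.+1 a)}|) F (tab_bits (tab r)).
Proof.
pose h (r : 'I_#|{: std_tableau n.+1 (hook n.+1 a)}|) := tab_bits (tab r).
have h_inj : injective h.
  move=> r s /(tab_bits_inj an (valP _) (valP _)) E.
  exact/enum_val_inj/val_inj.
have -> : \sum_(U | ones U == a) F U = \sum_(U in [seq h r | r <- enum 'I__])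
  F U.
  apply: eq_bigl => U; apply/eqP/mapP => [/(tab_bits_onto an) [t st tU]|[r _
    ->]].
    exists (enum_rank (Sub t st : std_tableau n.+1 (hook n.+1 a))).
      by rewrite mem_enum.
    by rewrite /h enum_rankK.
  exact: ones_tab (valP _).
rewrite -big_uniq /=; last by rewrite map_inj_uniq ?enum_uniq.
by rewrite big_map big_enum.
Qed.

Variable rho : H n.+1 -> 'M[k]_#|{: std_tableau n.+1 (hook n.+1 a)}|.
Hypothesis rho_repr : is_representation rho.
Hypothesis rho_T0 : rho (T n.+1 0) = (u p)%:M.
Hypothesis rho_T : forall i j : 'I_n.+1, j = i.+1 :> nat ->
  rho (T n.+1 j) = tab_mx q (hook n.+1 a) i j.

Lemma rho_kernel x s t : rho (\pi_(H n.+1) x) s t =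
  kernel x (tab_bits (tab s)) (tab_bits (tab t)).
Proof.
have [rho_lin rho1 rhoM] := rho_repr.
have eqst (i l : 'I_#|{: std_tableau n.+1 (hook n.+1 a)}|) :
    (tab_bits (tab i) == tab_bits (tab l)) = (i == l).
  by rewrite (eq_tab_bits an (valP _) (valP _)) val_eqE (inj_eq enum_val_inj).
have rho0 : rho 0 = 0.
  by have /eqP := rho_lin 1 0 0;
    rewrite !scale1r addr0 -subr_eq0 opprD addrA subrr sub0r oppr_eq0 => /eqP.
elim: x s t => [j|c|x IHx y IHy|x IHx y IHy] s t.
- rewrite -akTE; case: (posnP j) => [j0|j_gt0].
    by rewrite /= /gen_kernel j0 eqxx rho_T0 mxE eqst mulr_natr.
  have jn : (j.-1 < n.+1)%N by rewrite (leq_ltn_trans (leq_pred _)).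
  rewrite (rho_T (i := Ordinal jn)) /= ?prednK // mxE (tab_kernel (u p) _ an)
    /= ?prednK //.
  + by have := q_nroot 0; rewrite expr1.
  + exact: valP.
  + exact: valP.
- rewrite -ak_constpi -[_%:A]addr0 rho_lin rho0 rho1 addr0 mxE mxE /= eqst.
  by rewrite -mulr_natr mulrA mulr1 mulr_natr.
- by rewrite -ak_addpi -[\pi x]scale1r rho_lin scale1r mxE IHx IHy.
(* The kernel product runs over the hooks of every arm length; the terms outside the block of [a]
   vanish. *)
rewrite -ak_mulpi rhoM mxE /= [RHS](bigID (fun U => ones U == a)) /=.
rewrite sum_tab_bits [X in _ = _ + X]big1 => [|U Ua]; last first.
  by rewrite kernel_ones ?mul0r // (ones_tab an (valP _)) eq_sym.
by rewrite addr0; apply: eq_bigr => r _; rewrite IHx IHy.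
Qed.

Lemma tr_rho x : \tr (rho (\pi_(H n.+1) x)) = \sum_(U | ones U == a) kernel x
  U U.
Proof. by rewrite sum_tab_bits; apply: eq_bigr => r _; rewrite rho_kernel. Qed.

End OneHook.

Variable chi : 'I_n.+1 -> H n.+1 -> k.
Hypothesis chiP : forall a, is_hook_character a p (chi a).

(** Between different blocks both kernels vanish; within a block they are entries of a given
    representation, which only depends on the class of the term. *)
Lemma kernel_sound_top : kernel_sound n.
Proof.
move=> x y xy S S'; have [SS'|SS'] := eqVneq (ones S) (ones S'); last first.
  by rewrite !kernel_ones.
have Sn : (ones S < n.+1)%N by rewrite ltnS ones_le.
have [rho [rP r0 rT _]] := chiP (Ordinal Sn).
have [t st <-] := tab_bits_onto (ones_le S) (erefl _).
have [t' st' <-] := tab_bits_onto (ones_le S) (esym SS').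
have /ak_piP E := xy.
have := congr1 (fun z => rho z (enum_rank (Sub t st)) (enum_rank (Sub t'
  st'))) E.
by rewrite !(rho_kernel _ rP r0 rT) ?ones_le // !enum_rankK.
Qed.

Lemma sum_hook_character x :
  \sum_(a < n.+1) (-1) ^+ a * chi a (\pi_(H n.+1) x) = supertrace (kernel x).
Proof.
rewrite /supertrace (partition_big (fun U => inord (ones U) : 'I_n.+1) xpredT)
  //=.
apply: eq_bigr => a _; have [rho [rP r0 rT ->]] := chiP a.
have an : (a <= n)%N by rewrite -ltnS.
rewrite (tr_rho _ rP r0 rT) // mulr_sumr.
have ia (U : bits n) : (inord (ones U) == a) = (ones U == a).
  by rewrite -val_eqE /= inordK // ltnS ones_le.
rewrite [RHS](eq_bigl _ _ ia).
by apply: eq_bigr => U /eqP ->.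
Qed.

End Hooks.

Fixpoint widen_term n (x : aterm k 'I_n) : aterm k 'I_n.+1 :=
  match x with
  | AVar i => AVar k (widen_ord (leqnSn n) i)
  | AConst c => AConst c
  | AAdd x y => AAdd (widen_term x) (widen_term y)
  | AMul x y => AMul (widen_term x) (widen_term y)
  end.

Lemma ak_incl_widen n (x : aterm k 'I_n) :
  ak_incl (\pi_(H n) x) = \pi_(H n.+1) (widen_term x).
Proof.
rewrite ak_incl_pi -aeval_akT.
by elim: x => [i|c|x IHx y IHy|x IHx y IHy] //=; rewrite IHx IHy.
Qed.

(** Restriction to the smaller algebra: its generators neither read nor move the last bit. *)
Lemma kernel_widen n (x : aterm k 'I_n.+1) (S S' : bits n) b b' :
  kernel (widen_term x) (S, b) (S', b') = kernel x S S' * (b == b')%:R.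
Proof.
have pairE (A B : bits n) (c d : bool) :
    (((A, c) : bits n.+1) == (B, d))%:R = (A == B)%:R * (c == d)%:R :> k.
  by rewrite -natrM mulnb -pair_eqE.
elim: x S S' b b' => [j|c|x IHx y IHy|x IHx y IHy] S S' b b'.
- have jn := ltn_ord j.
  have sw : swap j ((S', b') : bits n.+1) = (swap j S', b').
    have sn i : (i <= n)%N -> (swapn j i <= n)%N.
      by rewrite /swapn; case: ifP => _; last case: ifP => _; lia.
    rewrite /swap /=; congr pair.
      by apply: eq_mkbits => i ni; rewrite ltn_eqF // ltnS sn.
    have -> : swapn j n.+1 = n.+1.
      by rewrite /swapn; do 2![case: eqP => [E|_]; first by lia].
    by rewrite eqxx.
  have bj i : (i <= n)%N -> bit ((S', b') : bits n.+1) i = bit S' i.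
    by move=> ni; rewrite /= ltn_eqF.
  have j1n : (j.-1 <= n)%N by lia.
  rewrite [LHS](_ : _ = gen_kernel q (u p) j ((S, b) : bits n.+1) (S', b')) //.
  rewrite /= /gen_kernel sw !pairE !bj //.
  case: ifP => _; first by rewrite mulrA.
  case: ifP => _; first by rewrite mulrA.
  by rewrite !mulrA -mulrDl !mulrA.
- by rewrite /= pairE mulrA.
- by rewrite /= IHx IHy mulrDl.
rewrite /= sum_bitsS mulr_suml; apply: eq_bigr => U _.
rewrite big_bool /= !IHx !IHy; case: b; case: b' => /=;
by rewrite ?mulr1 ?mulr0 ?mul0r ?addr0 ?add0r.
Qed.

(** Inclusion preserves congruence of terms, and the block of kernels with last bit [true] is a copy
    of the smaller kernel. *)
Lemma kernel_sound_pred n : kernel_sound n.+1 -> kernel_sound n.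
Proof.
move=> sound x y /ak_piP /(congr1 (@ak_incl _ _ _ _ _)).
rewrite !ak_incl_widen => /ak_piP /sound E S S'.
by have := E (S, true) (S', true); rewrite !kernel_widen eqxx !mulr1.
Qed.

(** The choice of [repr x] is immaterial once [kernel_sound] holds, by [kernel_repr]. *)
Definition hook_trace n (x : H n.+1) : k := supertrace (kernel (repr x)).

Section Sound.
Variables (n : nat) (sound : kernel_sound n).

Lemma kernel_repr x : kernel (repr (\pi_(H n.+1) x)) =2 kernel x.
Proof. exact/sound/ak_reprP. Qed.

Lemma hook_trace_pi x : hook_trace (\pi_(H n.+1) x) = supertrace (kernel x).
Proof. by apply: eq_bigr => S _; rewrite kernel_repr. Qed.

Lemma hook_trace_linear : scalar (@hook_trace n).
Proof.
move=> c; elim/ak_ind=> x; elim/ak_ind=> y.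
rewrite -mulr_algl ak_constpi ak_mulpi ak_addpi !hook_trace_pi /supertrace /=.
rewrite mulr_sumr -big_split; apply: eq_bigr => S _ /=; rewrite mulrDr.
congr (_ + _); rewrite (bigD1 S) //= eqxx big1 => [|U US].
  by rewrite addr0 mulr1 mulrCA.
by rewrite eq_sym (negPf US) mulr0 mul0r.
Qed.

(** The usual cyclicity: nonzero entries join states with equal [ones], hence with equal signs. *)
Lemma hook_traceC (x y : H n.+1) : hook_trace (x * y) = hook_trace (y * x).
Proof.
elim/ak_ind: x => x; elim/ak_ind: y => y; rewrite !ak_mulpi !hook_trace_pi.
rewrite /supertrace /=; under eq_bigr do rewrite mulr_sumr.
rewrite exchange_big; apply: eq_bigr => U _; rewrite mulr_sumr.
apply: eq_bigr => S _; rewrite [in RHS]mulrC mulrA.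
have [->|SU] := eqVneq (ones S) (ones U); first by rewrite mulrAC mulrC mulrA.
by rewrite [kernel x S U]kernel_ones // !(mulr0, mul0r).
Qed.

Definition acts_by (x : H n.+1) c :=
  forall S S', kernel (repr x) S S' = c * (S == S')%:R.

Lemma acts_by_mul (x y : H n.+1) (S S' : bits n) : kernel (repr (x * y)) S S' =
  \sum_U kernel (repr x) S U * kernel (repr y) U S'.
Proof.
elim/ak_ind: x => x; elim/ak_ind: y => y; rewrite ak_mulpi kernel_repr /=.
by apply: eq_bigr => U _; rewrite !kernel_repr.
Qed.

Lemma acts_by_mulr x y c : acts_by y c -> forall S S',
  kernel (repr (x * y)) S S' = c * kernel (repr x) S S'.
Proof.
move=> yc S S'; rewrite acts_by_mul (bigD1 S') //= yc eqxx mulr1 mulrC big1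
  ?addr0 //.
by move=> U US; rewrite yc (negPf US) !mulr0.
Qed.

Lemma acts_by1 : acts_by 1 1.
Proof. by move=> S S'; rewrite -[1]scale1r ak_constpi kernel_repr. Qed.

Lemma acts_by_exp x c j : acts_by x c -> acts_by (x ^+ j) (c ^+ j).
Proof.
move=> xc; elim: j => [|j IHj] S S'; first exact: acts_by1.
by rewrite exprSr (acts_by_mulr _ xc) IHj mulrA -exprS.
Qed.

Lemma acts_by_conj t x c : t \is a GRing.unit -> acts_by x c ->
  acts_by (t * x * t^-1) c.
Proof.
move=> tU xc S S'; rewrite acts_by_mul.
under eq_bigr => U _ do rewrite (acts_by_mulr _ xc) -mulrA.
by rewrite -mulr_sumr -acts_by_mul divrr // acts_by1 mul1r.
Qed.

Lemma acts_by_L i : (i < n.+1)%N -> acts_by (L n.+1 i) (u p).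
Proof.
elim: i => [|i IHi] ni.
  by rewrite /= (akTE q u (Ordinal ni)) => S S'; rewrite kernel_repr.
by apply: acts_by_conj; [apply: akT_unit | apply/IHi/ltnW].
Qed.

Lemma hook_trace_acts_by x y c : acts_by y c ->
  hook_trace (x * y) = c * hook_trace x.
Proof.
move=> yc; rewrite /hook_trace /supertrace mulr_sumr.
by apply: eq_bigr => S _; rewrite (acts_by_mulr _ yc) mulrCA.
Qed.

End Sound.

Section SoundStep.
Variables (n : nat) (sound : kernel_sound n.+1).

(** Diagonal coefficient of T_{n+1} when [c] and [b] tell whether the entries [n] and [n.+1] lie in
    the arm. *)
Let diag_coef (c b : bool) : k :=
  if c == b then (if b then q else -1)
  else (1 - q ^ signed_dist n.+1 b)^-1 * (q - 1).

Let gen_kernel_diag (U S : bits n) b :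
  gen_kernel q (u p) n.+1 ((U, b) : bits n.+1) (S, b) =
  (U == S)%:R * diag_coef (bit S n) b.
Proof.
have US : ((U, b) : bits n.+1) == (S, b) = (U == S).
  by rewrite -pair_eqE /= eqxx andbT.
rewrite /gen_kernel /diag_coef US /= eqxx ltn_eqF //.
case: ifPn => [_|Sb]; first by rewrite mulrC.
(* The bits at [n] and [n.+1] differ, so the swap changes the last one. *)
have -> : ((U, b) : bits n.+1) == swap n.+1 ((S, b) : bits n.+1) = false.
  have sn : swapn n.+1 n.+1 = n by rewrite /swapn /= gtn_eqF ?ltnSn // eqxx.
  rewrite /swap -pair_eqE /= sn ltn_eqF ?ltnSn //.
  by rewrite [b == _]eq_sym (negPf Sb) andbF.
by rewrite mulr0 addr0 mulrA mulrC.
Qed.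

Let diag_coef_sub c :
  diag_coef c false - diag_coef c true = - ((1 - q ^+ n.+2) / (1 - q ^+ n.+1)).
Proof.
have q1 : 1 - q ^+ n.+1 != 0 by rewrite subr_eq0 eq_sym.
have q2 : q ^+ n.+1 - 1 != 0 by rewrite subr_eq0.
have qn : q ^+ n.+1 != 0 by rewrite expf_neq0.
rewrite /diag_coef /signed_dist; case: c => /=.
  rewrite -exprnP [q ^+ n.+2]exprS; field; exact: q1.
rewrite -exprnN [q ^+ n.+2]exprS.
have -> : 1 - (q ^+ n.+1)^-1 = (q ^+ n.+1 - 1) / q ^+ n.+1 by field.
by field; rewrite q1 q2 qn.
Qed.

Let sound' : kernel_sound n. Proof. exact: kernel_sound_pred. Qed.

Lemma hook_trace_incl (h : H n.+1) : hook_trace (ak_incl h) = 0.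
Proof.
elim/ak_ind: h => x; rewrite ak_incl_widen hook_trace_pi // /supertrace
  sum_bitsS.
rewrite big1 // => S _; rewrite big_bool /= !kernel_widen.
by rewrite add1n add0n exprS mulN1r mulNr addNr.
Qed.

Lemma hook_trace_L (h : H n.+1) j : hook_trace (ak_incl h * L n.+2 n.+1 ^+ j)
  = 0.
Proof.
have Lj := acts_by_exp sound j (acts_by_L sound (ltnSn n.+1)).
by rewrite (hook_trace_acts_by sound _ Lj) hook_trace_incl mulr0.
Qed.

Lemma hook_trace_T (h : H n.+1) : hook_trace (ak_incl h * T n.+2 n.+1) =
  - ((1 - q ^+ n.+2) / (1 - q ^+ n.+1)) * hook_trace h.
Proof.
elim/ak_ind: h => x; rewrite ak_incl_widen (akTE q u (@ord_max n.+1)) ak_mulpi.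
rewrite !hook_trace_pi // /supertrace sum_bitsS mulr_sumr.
apply: eq_bigr => S _.
(* The widened factor keeps the last bit, and between states with the same last bit the generator is
   diagonal. *)
have diag b : kernel (AMul (widen_term x) (AVar k ord_max)) (S, b) (S, b) =
    kernel x S S * diag_coef (bit S n) b.
  rewrite /= sum_bitsS (bigD1 S) //= [X in _ + X]big1 ?addr0 => [|U US].
    rewrite (bigD1 b) //= big1 => [|c cb].
      by rewrite addr0 kernel_widen eqxx mulr1 gen_kernel_diag eqxx mul1r.
    by rewrite kernel_widen eq_sym (negPf cb) mulr0 mul0r.
  rewrite big1 // => c _; rewrite kernel_widen; have [<-|_] := eqVneq b c.
    by rewrite gen_kernel_diag (negPf US) mul0r mulr0.
  by rewrite mulr0 mul0r.
rewrite big_bool !diag /= add1n add0n exprS -(diag_coef_sub (bit S n)).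
by ring.
Qed.

End SoundStep.
End HookTrace.

(** * Interpolation at the parameters *)

Section Interpolation.
Variables (K : fieldType) (e : nat) (v : 'I_e -> K).

Let Q (p : 'I_e) : {poly K} := \prod_(l < e | l != p) ('X - (v l)%:P).

Let size_Q p : size (Q p) = e.
Proof.
have P1 := size_prod_XsubC (index_enum 'I_e) v; move: P1.
rewrite (bigD1 p) //= -/(Q p) mulrC size_Mmonic ?monicXsubC //; last first.
  by apply/monic_neq0/monic_prod => l _; exact: monicXsubC.
by rewrite size_XsubC addn2 /index_enum -enumT size_enum_ord => -[].
Qed.

(** Write ['X^j] by Lagrange interpolation at the points [v p], then apply the linear form sending
    ['X^i] to [y i]. *)
Lemma lagrange_sum : injective v -> forall y : nat -> K, forall j, (j < e)%N ->
  \sum_(p < e) (\sum_(i < e) y i * (Q p)`_i) *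
     (\prod_(l < e | l != p) (v p - v l)^-1) * v p ^+ j = y j.
Proof.
move=> v_inj y j je.
pose c p := \prod_(l < e | l != p) (v p - v l)^-1.
have XjE : \sum_p (c p * v p ^+ j) *: Q p = 'X^j.
  apply/eqP; rewrite -subr_eq0; apply/eqP.
  apply: (@roots_geq_poly_eq0 _ _ [seq v p | p <- enum 'I_e]).
  - apply/allP => _ /mapP[p _ ->]; rewrite rootE hornerD hornerN hornerXn.
    rewrite subr_eq0 horner_sum (bigD1 p) //= [X in _ + X]big1 ?addr0 => [|l
      lp].
      rewrite hornerZ horner_prod mulrAC -big_split /= big1 ?mul1r //.
      move=> l lp; rewrite hornerXsubC mulVf // subr_eq0 (inj_eq v_inj).
      by rewrite eq_sym.
    rewrite hornerZ horner_prod (bigD1 p); last by rewrite eq_sym.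
    by rewrite /= hornerXsubC subrr mul0r mulr0.
  - by rewrite map_inj_uniq ?enum_uniq.
  rewrite size_map size_enum_ord (leq_trans (size_polyD _ _)) // geq_max.
  rewrite size_polyN size_polyXn je andbT.
  apply: (leq_trans (size_sum _ _ _)); apply/bigmax_leqP => p _.
  by rewrite (leq_trans (size_scale_leq _ _)) ?size_Q.
transitivity (\sum_(i < e) y i * ('X^j : {poly K})`_i); last first.
  rewrite (bigD1 (Ordinal je)) //= coefXn eqxx mulr1 big1 ?addr0 // => i ij.
  by rewrite coefXn (_ : (i == j :> nat) = false) ?mulr0 //; apply: contraNF ij.
rewrite -XjE; under [RHS]eq_bigr do rewrite coef_sum mulr_sumr.
rewrite exchange_big; apply: eq_bigr => p _; rewrite -mulrA mulr_suml.
by apply: eq_bigr => i _; rewrite coefZ -/(c p) -mulrA [(Q p)`_i * _]mulrC.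
Qed.

(** Division of the full product by ['X - v p]: comparing coefficients gives [coefP], which
    telescopes after weighting by powers of [v p]. *)
Lemma coef_prod_but p j : (j < e)%N -> (Q p)`_j =
  \sum_(j <= i < e) v p ^+ (e - i - 1) *
     (\prod_(l < e) ('X - (v l)%:P) : {poly K})`_(e - (i - j)).
Proof.
move=> je; set P := \prod_(l < e) _.
have coefP m : P`_m.+1 = (Q p)`_m - v p * (Q p)`_m.+1.
  by rewrite /P (bigD1 p) //= -/(Q p) mulrBl coefB coefXM coefCM.
rewrite (@telescope_sumr_eq _ j e
  (fun i => v p ^+ (e - i) * (Q p)`_(e - i + j))); first last.
- move=> i /andP[ji ie]; have [d ed] : {d | (e = i + d.+1)%N}.
    by exists (e - i.+1)%N; lia.
  have -> : (e - (i - j) = (d + j).+1)%N by lia.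
  rewrite coefP; have -> : (e - i = d.+1)%N by lia.
  have -> : (e - i.+1 = d)%N by lia.
  rewrite subn1 /= addSn exprS; ring.
- exact: ltnW.
rewrite subnn add0n expr0 mul1r subnK ?(ltnW je) //.
by rewrite [X in _ * X]nth_default ?size_Q // mulr0 subr0.
Qed.

Lemma coef0_prod_but p :
  (Q p)`_0 = (-1) ^+ e.-1 * \prod_(l < e | l != p) v l.
Proof.
rewrite -horner_coef0 horner_prod.
under eq_bigr do rewrite hornerXsubC sub0r.
rewrite prodrN; congr (_ ^+ _ * _).
by rewrite (cardC1 p) card_ord.
Qed.

Lemma coef_prod_mesym d : (d <= e)%N ->
  (\prod_(l < e) ('X - (v l)%:P) : {poly K})`_(e - d) = (-1) ^+ d * (mesym e K
    d).@[v].
Proof.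
move=> de; have := mroots_coeff [tuple v l | l < e] (Ordinal (de : (d <
  e.+1)%N)).
rewrite big_map => /=.
have -> : (mesym e K d).@[tnth [tuple v l | l < e]] = (mesym e K d).@[v].
  by apply: meval_eq => l; rewrite tnth_mktuple.
by move=> <-; rewrite !big_enum.
Qed.

End Interpolation.

Lemma sum_nat_triangle (V : nmodType) m n (F : nat -> nat -> V) :
  \sum_(m <= i < n) \sum_(m <= j < i.+1) F i j =
  \sum_(m <= j < n) \sum_(j <= i < n) F i j.
Proof.
transitivity (\sum_(m <= i < n) \sum_(m <= j < n | (j < i.+1)%N) F i j).
  by apply: eq_big_nat => i /andP[_ ni]; rewrite (big_nat_widen _ _ n).
rewrite (exchange_big_dep_nat xpredT) //; apply: eq_big_nat => j /andP[mj _].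
by rewrite [RHS](big_nat_widenl j m).
Qed.

Section HookWeight.
Variables (e : nat) (K : fieldType) (iota : {rmorphism akField e -> K}).

(** The weight is the linear form sending 1 to 1 and ['X^j] to [y j], applied to the product of the
    ['X - u_l] with l distinct from p. The constant term gives the isolated summand, and Vieta's
    formulas give the rest. *)
Lemma hook_weightE (y : nat -> K) (p : 'I_e) : (0 < e)%N ->
  hook_weight iota y p = \sum_(j < e) (if j == 0 :> nat then 1 else y j) *
    (\prod_(l < e | l != p) ('X - (iota (ak_u l))%:P) : {poly K})`_j.
Proof.
move=> e0; pose v l := iota (ak_u l).
rewrite /hook_weight -(big_mkord xpredT (fun j => (if j == 0 then 1 else y j) *
    (\prod_(l < e | l != p) ('X - (v l)%:P) : {poly K})`_j)).
rewrite [in RHS]big_ltn // mul1r (coef0_prod_but v) addrC; congr (_ + _).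
transitivity (\sum_(1 <= i < e) \sum_(1 <= j < i.+1)
    (v p ^+ (e - i - 1) * ((-1) ^+ (i - j) * y j * sigma iota (i - j)))).
  by apply: eq_bigr => i _; rewrite mulr_sumr.
rewrite sum_nat_triangle; apply: eq_big_nat => j /andP[j1 je].
rewrite gtn_eqF // (coef_prod_but v p je) mulr_sumr.
apply: eq_big_nat => i /andP[ji ie].
have eij : (i - j <= e)%N by rewrite (leq_trans (leq_subr _ _)) // ltnW.
rewrite (coef_prod_mesym v eij) /sigma -/v; ring.
Qed.

End HookWeight.

(** * The limit of the Markov trace *)

Section Evaluation.
Variables (K : fieldType) (x : K).
Implicit Types (f g : ratfun K) (c d : K).

Lemma tofrac_neq0 (p : {poly K}) : p.[x] != 0 -> tofrac p != 0 :> ratfun K.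
Proof. by rewrite tofrac_eq0; apply: contraNneq => ->; rewrite horner0. Qed.

Lemma evaluates_to_frac (num den : {poly K}) : den.[x] != 0 ->
  evaluates_to (tofrac num / tofrac den) x (num.[x] / den.[x]).
Proof. by move=> dx; exists num, den. Qed.

Lemma evaluates_to_poly (p : {poly K}) : evaluates_to (tofrac p) x p.[x].
Proof.
have := @evaluates_to_frac p 1; rewrite hornerE oner_eq0 => /(_ isT).
by rewrite tofrac1 !divr1.
Qed.

Lemma evaluates_to_const c : evaluates_to (ratfun_const c) x c.
Proof. by have := evaluates_to_poly c%:P; rewrite hornerC. Qed.

Lemma evaluates_to_add f g c d : evaluates_to f x c -> evaluates_to g x d ->
  evaluates_to (f + g) x (c + d).
Proof.
move=> [n1 [d1 [d1x -> ->]]] [n2 [d2 [d2x -> ->]]].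
have d12 : (d1 * d2).[x] != 0 by rewrite hornerM mulf_neq0.
have := evaluates_to_frac (n1 * d2 + n2 * d1) d12.
rewrite tofracD !tofracM hornerD !hornerM -addf_div ?tofrac_neq0 //.
by rewrite -addf_div.
Qed.

Lemma evaluates_to_mul f g c d : evaluates_to f x c -> evaluates_to g x d ->
  evaluates_to (f * g) x (c * d).
Proof.
move=> [n1 [d1 [d1x -> ->]]] [n2 [d2 [d2x -> ->]]].
have d12 : (d1 * d2).[x] != 0 by rewrite hornerM mulf_neq0.
by have := evaluates_to_frac (n1 * n2) d12;
  rewrite !tofracM !hornerM -!mulf_div.
Qed.

Lemma evaluates_to_sqrt_t (m : int) : x != 0 ->
  evaluates_to (sqrt_t K ^ m) x (x ^ m).
Proof.
move=> x0; have Xx j : ('X^j).[x] = x ^+ j by rewrite hornerXn.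
case: m => j.
  by have := evaluates_to_poly 'X^j; rewrite Xx tofracXn.
have xj : ('X^(j.+1) : {poly K}).[x] != 0 by rewrite Xx expf_neq0.
have := evaluates_to_frac 1 xj.
by rewrite Xx tofracXn tofrac1 (hornerC 1 x) !div1r.
Qed.

End Evaluation.

(** * The leading part of the trace in [z] *)

Section MarkovLimit.
Variables (k : fieldType) (e : nat) (q : k) (u : 'I_e -> k).
Hypotheses (e_gt0 : (0 < e)%N) (q_neq0 : q != 0) (u_neq0 : forall p, u p != 0).
Hypothesis q_nroot : forall i, q ^+ i.+1 != 1.

Local Notation H := (akAlg q u).
Local Notation T := (akT q u).
Local Notation L := (akL q u).

Variables (K : fieldType) (iota : {rmorphism k -> K}) (x : K) (z : ratfun K).
Hypotheses (z_neq0 : z != 0) (zV_x : evaluates_to z^-1 x 0).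
Variables (y : nat -> K) (tau : forall m, H m -> ratfun K).
Hypothesis tauP : is_markov_trace (fun c => ratfun_const (iota c)) z
  (fun j => ratfun_const (y j)) tau.
Variable w : 'I_e -> K.
Hypothesis w_interp : forall j, (j < e)%N ->
  \sum_p w p * iota (u p) ^+ j = if j == 0%N then 1 else y j.

(** The factor before the sum inverts the product of the scalars of [hook_trace_T] over the steps
    from H_1 up to H_{n+1}. *)
Definition trace_limit n (h : H n.+1) : K :=
  (-1) ^+ n * ((1 - iota q) / (1 - iota q ^+ n.+1)) *
  \sum_p w p * iota (hook_trace p h).

Section Fixed.
Variables (n : nat) (sound : forall p, kernel_sound q u p n).

Lemma trace_limit_linear c (h h' : H n.+1) :
  trace_limit (c *: h + h') = iota c * trace_limit h + trace_limit h'.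
Proof.
rewrite /trace_limit [iota c * _]mulrCA -mulrDr; congr (_ * _).
rewrite mulr_sumr -big_split; apply: eq_bigr => p _ /=.
by rewrite hook_trace_linear // rmorphD rmorphM mulrDr mulrCA.
Qed.

Lemma trace_limitD (h h' : H n.+1) :
  trace_limit (h + h') = trace_limit h + trace_limit h'.
Proof. by rewrite -[h]scale1r trace_limit_linear rmorph1 mul1r scale1r. Qed.

Lemma tauD m (h h' : H m) : tau (h + h') = tau h + tau h'.
Proof.
rewrite -[h in LHS]scale1r (markov_linear tauP) rmorph1.
by rewrite /ratfun_const tofrac1 mul1r.
Qed.

End Fixed.

Lemma iota_q_nroot i : iota q ^+ i.+1 != 1.
Proof. by rewrite -rmorphXn fmorph_eq1. Qed.

Lemma tau_limit0 (h : H 1) : (forall p, kernel_sound q u p 0) ->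
  evaluates_to (tau h) x (trace_limit h).
Proof.
move=> sound; have [c ->] := ak1_span e_gt0 q_neq0 u_neq0 h.
have tau0 : tau (0 : H 1) = 0.
  have := tauD (0 : H 1) 0; rewrite addr0 => /eqP.
  by rewrite -subr_eq0 opprD addrA subrr sub0r oppr_eq0 => /eqP.
have lim0 : trace_limit (0 : H 1) = 0.
  have := trace_limitD sound (0 : H 1) 0; rewrite addr0 => /eqP.
  by rewrite -subr_eq0 opprD addrA subrr sub0r oppr_eq0 => /eqP.
elim/big_rec: _ => [|j h' _ IH].
  by rewrite tau0 lim0; have := evaluates_to_const x (0 : K);
    rewrite /ratfun_const tofrac0.
rewrite (markov_linear tauP) trace_limit_linear //.
apply: evaluates_to_add => //; apply: evaluates_to_mul;
  first exact: evaluates_to_const.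
have -> : tau (T 1 0 ^+ j) = ratfun_const (if j == 0 :> nat then 1 else y j).
  have [->|j0] := eqVneq (j : nat) 0%N.
    by rewrite (markov_one tauP) /ratfun_const tofrac1.
  (* At level 0, L is T_0 itself, so this condition gives the trace of its powers. *)
  have := @markov_L _ _ _ _ _ _ _ _ _ tauP 0 1 j.
  by rewrite rmorph1 mul1r (markov_one tauP) mulr1 /= lt0n j0 ltn_ord => ->.
suff -> : trace_limit (T 1 0 ^+ j) = if j == 0 :> nat then 1 else y j.
  exact: evaluates_to_const.
rewrite -w_interp // /trace_limit expr0 mul1r expr1 divff ?mul1r; last first.
  by rewrite subr_eq0 eq_sym -[iota q]expr1 iota_q_nroot.
apply: eq_bigr => p _; congr (_ * _).
have Tj := acts_by_exp (sound p) j (acts_by_L e_gt0 q_neq0 u_neq0 (sound p)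
  (ltn0Sn 0)).
rewrite -[T 1 0 ^+ j]mul1r (hook_trace_acts_by (sound p) _ Tj) -rmorphXn.
rewrite /hook_trace /supertrace (bigD1 tt) //= big1 => [|[]//].
by rewrite acts_by1 // eqxx expr0 !mulr1 addr0 mulr1.
Qed.

(** Induction along [tower_spanP]: on a [T] term the new factor [z] cancels one [z^-1], while on an
    [L] term no [z] appears and the extra [z^-1] evaluates to 0. *)
Theorem tau_limit n (h : H n.+1) : (forall p, kernel_sound q u p n) ->
  evaluates_to (z^-1 ^+ n * tau h) x (trace_limit h).
Proof.
elim: n h => [|n IHn] h sound.
  by rewrite expr0 mul1r; apply: tau_limit0.
have sound' p : kernel_sound q u p n by apply/kernel_sound_pred/sound.
elim: {h}(tower_spanP e_gt0 q_neq0 u_neq0 h) => [h h'|h j je|a b _ IHa _ IHb].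
- rewrite (markov_comm tauP) mulrA -rmorphM (markov_T tauP) //.
  rewrite exprSr -mulrA mulKf //.
  have -> : trace_limit (ak_incl h * T n.+2 n.+1 * ak_incl h') = trace_limit
    (h' * h).
    rewrite /trace_limit.
    under eq_bigr => p _ do
      rewrite hook_traceC // mulrA -rmorphM hook_trace_T // rmorphM mulrCA.
    rewrite -mulr_sumr [LHS]mulrA; congr (_ * _).
    rewrite rmorphN fmorph_div !rmorphB !rmorph1 !rmorphXn /= [(-1) ^+
      n.+1]exprS.
    have qn i : 1 - iota q ^+ i.+1 != 0 by rewrite subr_eq0 eq_sym iota_q_nroot.
    by field; rewrite !qn.
  exact: IHn.
- have -> : trace_limit (ak_incl h * L n.+2 n.+1 ^+ j) = 0.
    rewrite /trace_limit big1 ?mulr0 // => p _.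
    by rewrite hook_trace_L // rmorph0 mulr0.
  have [c ->] : exists c, tau (ak_incl h * L n.+2 n.+1 ^+ j) = ratfun_const c
    * tau h.
    (* The exponent 0 comes under compatibility with inclusions, the positive ones under the
       condition on [L]. *)
    case: j je => [|j] je.
      exists 1; rewrite expr0 mulr1 (markov_incl tauP).
      by rewrite /ratfun_const tofrac1 mul1r.
    by exists (y j.+1); rewrite (markov_L tauP).
  rewrite exprS -mulrA [z^-1 ^+ n * _]mulrCA -[0](mul0r (c * trace_limit h)).
  apply: evaluates_to_mul => //; apply: evaluates_to_mul; last exact: IHn.
  exact: evaluates_to_const.
rewrite tauD mulrDr trace_limitD //; exact: evaluates_to_add.
Qed.

End MarkovLimit.

(** * Genericity of the parameters, by specialising the indeterminates *)

Section BaseField.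
Variable e : nat.

Lemma ak_q_neq0 : ak_q e != 0.
Proof.
rewrite tofrac_eq0; apply/eqP => /(congr1 (meval (fun=> 1))).
by rewrite mevalXU meval0 => /eqP; rewrite oner_eq0.
Qed.

Lemma ak_u_neq0 (p : 'I_e) : ak_u p != 0.
Proof.
rewrite tofrac_eq0; apply/eqP => /(congr1 (meval (fun=> 1))).
by rewrite mevalXU meval0 => /eqP; rewrite oner_eq0.
Qed.

Lemma ak_u_inj : injective (@ak_u e).
Proof.
move=> p l /eqP; rewrite tofrac_eq => /eqP.
move=> /(congr1 (meval (fun i => (i == lift ord0 p)%:R)));
  rewrite !mevalXU eqxx.
by case: eqP => [/lift_inj //|_ /eqP]; rewrite oner_eq0.
Qed.

Lemma ak_q_nroot i : ak_q e ^+ i.+1 != 1.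
Proof.
rewrite -tofracXn -tofrac1 tofrac_eq; apply/eqP => /(congr1 (meval (fun=> 0))).
rewrite rmorphXn /= mevalXU meval1 exprS mul0r => /esym/eqP.
by rewrite oner_eq0.
Qed.

End BaseField.

(** * The parameter [z] at t = 1/q *)

Section VarZ.
Variables (e : nat) (K : fieldType) (iota : {rmorphism akField e -> K}).
Variables (sqrt_q : K) (sqrt_qE : sqrt_q ^+ 2 = iota (ak_q e)).

Let Q : K := iota (ak_q e).

Lemma iota_q_neq1 : 1 - Q != 0.
Proof. by rewrite subr_eq0 eq_sym fmorph_eq1; have := ak_q_nroot e 0. Qed.

Lemma sqrt_q_neq0 : sqrt_q != 0.
Proof. by rewrite -sqrf_eq0 sqrt_qE fmorph_eq0 ak_q_neq0. Qed.

Lemma one_sub_qE : 1 - emb_K iota (ak_q e) = tofrac (1 - Q)%:P :> ratfun K.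
Proof. by rewrite /emb_K /ratfun_const polyCB tofracB tofrac1. Qed.

Lemma one_sub_tqE : 1 - var_t K * emb_K iota (ak_q e) =
  tofrac (1 - 'X^2 * Q%:P) :> ratfun K.
Proof. by rewrite tofracB tofrac1 tofracM tofracXn. Qed.

Lemma var_z_inv : (var_z iota)^-1 =
  tofrac (- (1 - 'X^2 * Q%:P)) / tofrac (1 - Q)%:P.
Proof. by rewrite /var_z invrN invf_div one_sub_qE one_sub_tqE tofracN mulNr.
  Qed.

Lemma var_z_neq0 : var_z iota != 0.
Proof.
rewrite -invr_eq0 var_z_inv mulf_neq0 ?invr_eq0 ?(@tofrac_neq0 _ 0) //.
  by rewrite !hornerE /= expr0n /= mul0r subr0 oppr_eq0 oner_eq0.
by rewrite hornerC iota_q_neq1.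
Qed.

Lemma var_z_inv_at : evaluates_to (var_z iota)^-1 sqrt_q^-1 0.
Proof.
rewrite var_z_inv.
have d : ((1 - Q)%:P).[sqrt_q^-1] != 0 by rewrite hornerC iota_q_neq1.
have := evaluates_to_frac (- (1 - 'X^2 * Q%:P)) d.
suff -> : (- (1 - 'X^2 * Q%:P)).[sqrt_q^-1] = 0 by rewrite mul0r.
rewrite hornerN hornerD hornerN hornerM hornerXn !hornerC /Q -sqrt_qE -exprMn.
by rewrite mulVf ?sqrt_q_neq0 // expr1n subrr oppr0.
Qed.

End VarZ.

Theorem theorem6p9 (e n : nat) (e_gt0 : (0 < e)%N) (n_gt0 : (0 < n)%N)
    (K : fieldType) (iota : {rmorphism akField e -> K})
    (sqrt_q : K) (sqrt_qE : sqrt_q ^+ 2 = iota (ak_q e))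
    (y : nat -> K)
    (tau : forall m : nat, akH e m -> ratfun K)
    (tauP : is_markov_trace (emb_K iota) (var_z iota)
              (fun j : nat => ratfun_const (y j)) tau)
    (chi : 'I_n -> 'I_e -> akH e n -> akField e)
    (chiP : forall (a : 'I_n) (p : 'I_e), is_hook_character a p (chi a p))
    (alpha : affBraid n) :
  alexander_is iota sqrt_q tau alpha
    ((-1) ^+ n.-1 * sqrt_q ^ (n%:Z - writhe alpha - 1)
     * ((1 - iota (ak_q e)) / (1 - iota (ak_q e) ^+ n))
     * \sum_(a < n) \sum_(p < e)
         (-1) ^+ a * hook_weight iota y p
         * (\prod_(l < e | l != p) (iota (ak_u p) - iota (ak_u l))^-1)
         * iota (chi a p (br_to_ak (ak_q e) (@ak_u e) alpha))).
Proof.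
case: n n_gt0 chi chiP alpha => // n _ chi chiP alpha.
pose v p := iota (@ak_u e p).
pose w p := hook_weight iota y p * \prod_(l < e | l != p) (v p - v l)^-1.
have w_interp j : (j < e)%N ->
    \sum_p w p * iota (ak_u p) ^+ j = if j == 0%N then 1 else y j.
  have v_inj : injective v by move=> p l /fmorph_inj/ak_u_inj.
  move=> je; rewrite -(lagrange_sum v_inj (fun j => if j == 0%N then 1 else y
    j) je).
  by apply: eq_bigr => p _; rewrite /w hook_weightE.
set h := br_to_ak (ak_q e) (@ak_u e) alpha.
have sound p : kernel_sound (ak_q e) (@ak_u e) p n.
  exact: (kernel_sound_top (@ak_q_nroot e) (chiP^~ p)).
have lim := tau_limit e_gt0 (ak_q_neq0 e) (@ak_u_neq0 e) (@ak_q_nroot e)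
  (var_z_neq0 iota) (var_z_inv_at sqrt_qE) tauP w_interp h sound.
(* The bracket in the HOMFLYPT normalisation is [z^-1] divided by [sqrt_t]. *)
have homE : homflypt iota tau alpha =
    sqrt_t K ^ (writhe alpha - n%:Z) * ((var_z iota)^-1 ^+ n * tau n.+1 h).
  have s0 : sqrt_t K != 0 by rewrite tofrac_eq0 polyX_eq0.
  rewrite /homflypt /= [X in X ^+ n](_ : _ = (sqrt_t K)^-1 * (var_z iota)^-1).
    rewrite exprMn expfzDr // -exprnN -exprVn [RHS]mulrA; congr (_ * _).
    by rewrite mulrAC [_ * sqrt_t K ^ _]mulrC.
  by rewrite /var_z invrN invf_div invfM mulrN mulrCA.
rewrite /alexander_is homE.
have -> : (-1) ^+ n.+1.-1 * sqrt_q ^ (n.+1%:Z - writhe alpha - 1) *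
    ((1 - iota (ak_q e)) / (1 - iota (ak_q e) ^+ n.+1)) *
    (\sum_(a < n.+1) \sum_(p < e) (-1) ^+ a * hook_weight iota y p *
       (\prod_(l < e | l != p) (iota (ak_u p) - iota (ak_u l))^-1) *
       iota (chi a p h)) =
   sqrt_q^-1 ^ (writhe alpha - n%:Z) * trace_limit iota w h.
  (* Evaluation at [sqrt_q^-1] reverses the sign of the exponent [writhe alpha - n]. *)
  have -> : n.+1%:Z - writhe alpha - 1 = - (writhe alpha - n%:Z) by lia.
  rewrite exprz_inv /trace_limit /= -!mulrA mulrCA;
    congr (_ * (_ * (_ * (_ * _)))).
  rewrite exchange_big; apply: eq_bigr => p _.
  have -> : hook_trace p h = \sum_(a < n.+1) (-1) ^+ a * chi a p h.
    rewrite -[h in RHS]reprK.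
    exact: esym (sum_hook_character (@ak_q_nroot e) (chiP^~ p) _).
  rewrite rmorph_sum mulr_sumr; apply: eq_bigr => a _.
  rewrite rmorphM rmorphXn rmorphN1 /w -/(v p); ring.
apply: evaluates_to_mul lim; apply: evaluates_to_sqrt_t.
by rewrite invr_eq0 (sqrt_q_neq0 sqrt_qE).
Qed.
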